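(* Let $I_n$ denote the number of isolated vertices of the random Catalan-pair graph $CP_n$, and let $$\gamma = 4\sum_{m=1}^{\infty}16^{-m}\sum_{b=0}^{m-1}\binom{2m-2}{2b}C_{m-1-b}C_b \;(=0.3023\ldots).$$ Then $\mathbb{E}[I_n]\sim \gamma n$ as $n\to\infty$, and for every $\epsilon>0$, $\Pr[\,|I_n-\gamma n|<\epsilon n\,]\to 1$ as $n\to\infty$.
   Context: $C_m=\frac{1}{m+1}\binom{2m}{m}$ is the $m$-th Catalan number. A Catalan-arc matching of size $m$ on $2m$ points $p_1<\dots<p_{2m}$ of a line is a perfect matching of these points with no two arcs crossing, i.e. there are no $a<b<c<d$ with $\{p_a,p_c\}$ and $\{p_b,p_d\}$ both arcs; there are $C_m$ of them. The random Catalan-pair graph $CP_n$: take the points $1,\dots,2n$ on a line; color each of $1,\dots,2n-1$ red or blue independently and uniformly, and color point $2n$ so that the number of red points is even. If there are $2k$ red points, choose independently and uniformly a Catalan-arc matching of size $k$ on the red points and one of size $n-k$ on the blue points. $CP_n$ has one vertex per arc ($n$ vertices), two vertices adjacent iff the endpoints of the two arcs alternate (arcs $\{a,c\},\{b,d\}$ with $a<b<c<d$). *)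

(* Defs.v *)
From mathcomp Require Import all_boot.
From Stdlib Require Import Reals.
Set Implicit Arguments.
Unset Strict Implicit.
Unset Printing Implicit Defensive.

(* Points 1..2n of the paper are represented by 'I_(2*n) = {0,..,2n-1}.
   A coloring is c : {ffun 'I_(2n) -> bool}, with true = red. *)
Definition coloring (n : nat) := {ffun 'I_(2 * n) -> bool}.

(* A pair of matchings (red, blue) is encoded as one partner function m:
   m x is the point matched to x. *)
Definition partner (n : nat) := {ffun 'I_(2 * n) -> 'I_(2 * n)}.

Definition crosses n (m : partner n) (a b : 'I_(2 * n)) : bool :=
  [&& (a < b)%N, (b < m a)%N & (m a < m b)%N].

(* m is a perfect matching such that each arc is monochromatic and
   no two arcs of the same color cross: i.e. m is the union of a
   Catalan-arc (noncrossing) matching on the red points and one on the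
   blue points. *)
Definition valid_pair n (c : coloring n) (m : partner n) : bool :=
  [forall x, [&& m (m x) == x, m x != x & c (m x) == c x]] &&
  [forall a, forall b, (c a == c b) ==> ~~ crosses m a b].

(* the sample space of matching pairs for a given coloring; choosing the
   red and blue matchings independently and uniformly is the same as
   choosing m uniformly in this list *)
Definition valid_pairs n (c : coloring n) : seq (partner n) :=
  [seq m <- enum (partner n) | valid_pair c (m : partner n)].

(* colorings with an even number of red points: these are exactly the
   outcomes of coloring 1..2n-1 uniformly and fixing the parity with 2n;
   each has probability 2^-(2n-1). *)
Definition even_colorings n : seq (coloring n) :=
  [seq c <- enum (coloring n) | ~~ odd #|[set i | (c : coloring n) i]|].

(* number of isolated vertices of the graph: arcs {x, m x} (x < m x)
   whose endpoints alternate with those of no other arc *)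
Definition isolated n (m : partner n) : nat :=
  #|[set x : 'I_(2 * n) | (x < m x)%N && [forall y, ~~ (crosses m x y || crosses m y x)]]|.

Definition catalan (m : nat) : nat := 'C(2 * m, m) %/ m.+1.

Definition Rsum {T} (s : seq T) (f : T -> R) : R :=
  foldr (fun x acc => (f x + acc)%R) 0%R s.

Definition expected_isolated (n : nat) : R :=
  Rsum (even_colorings n) (fun c =>
    ((/ 2) ^ (2 * n - 1) *
     Rsum (valid_pairs c) (fun m =>
        INR (isolated m) / INR (size (valid_pairs c))))%R).

Definition prob_close (n : nat) (g eps : R) : R :=
  Rsum (even_colorings n) (fun c =>
    ((/ 2) ^ (2 * n - 1) *
     Rsum (valid_pairs c) (fun m =>
        (if Rlt_dec (Rabs (INR (isolated m) - g * INR n)) (eps * INR n)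
         then 1 else 0) / INR (size (valid_pairs c))))%R).

Definition gamma_term (k : nat) : R :=
  match k with
  | 0 => 0%R
  | S _ => (4 * (/ 16) ^ k *
            INR (\sum_(b < k) 'C(2 * k - 2, 2 * b) * catalan (k - 1 - b)
                                 * catalan b)%N)%R
  end.

(* Main.v *)
(* An isolated arc {x, y} splits a Catalan pair into a pair inside the interval
   ]x, y[ and a pair outside it. Recolouring each point by its colour together
   with its position (on the arc, inside, outside) turns "matchings in which
   {x, y} is isolated" into the monochromatic noncrossing matchings of a finer
   colouring, so all probabilities are ratios of products of Catalan numbers.
   Since C_(k-i) / C_k >= 4^-i with a ratio tending to 1, the arc {x, y} is
   isolated with probability at least, and asymptotically equal to, a constant
   q(y - x), where 2 q(2k - 1) is the k-th term of gamma, and two disjoint arcs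
   are asymptotically independent; hence the number of isolated arcs of length
   less than W satisfies a law of large numbers by the second moment method.
   Long arcs are negligible: given the colouring, the partner of x has i points
   of its own colour in between with probability C_i' C_j' / C_k', and the mass
   of the middle range of i is at most the normalised central binomial
   coefficient, because both end ranges are bounded below. Altogether
   E|I_n - gamma n| = o(n), which gives both claims. *)
Require Import Defs.
From Stdlib Require Import Reals.
From mathcomp Require Import all_boot all_order all_algebra archimedean Rstruct.
From mathcomp Require Import zify ring lra.
Set Implicit Arguments.
Unset Strict Implicit.
Unset Printing Implicit Defensive.

(** * Catalan numbers *)

(** Makes the truncated division in [catalan] exact: the quotient is the difference of two
    neighbouring binomial coefficients. *)
Lemma dvdn_succ_bin_central m : m.+1 %| 'C(2 * m, m).
Proof.
have h : 'C(2 * m, m) = m.+1 * ('C(2 * m, m) - 'C(2 * m, m.+1)).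
  have := mul_bin_left (2 * m) m; rewrite (_ : 2 * m - m = m); last by lia.
  by rewrite mulnBr => ->; rewrite mulSn addnK.
by rewrite h dvdn_mulr.
Qed.

Lemma catalanE m : m.+1 * catalan m = 'C(2 * m, m).
Proof. by rewrite /catalan mulnC divnK // dvdn_succ_bin_central. Qed.

Lemma bin_centralS m : m.+1 * 'C(2 * m.+1, m.+1) = 2 * (2 * m).+1 * 'C(2 * m, m).
Proof.
rewrite (_ : 2 * m.+1 = (2 * m).+2); last by lia.
have h1 := mul_bin_diag (2 * m).+2 m.
have h2 := mul_bin_diag (2 * m).+1 m.
rewrite /= in h1 h2.
have h3 : 'C((2 * m).+1, m) = 'C((2 * m).+1, m.+1).
  by rewrite -[RHS]bin_sub; [congr 'C(_, _); lia | lia].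
rewrite -h1 h3; apply/eqP; rewrite -(eqn_pmul2l (ltn0Sn m)); apply/eqP.
by rewrite mulnCA -h2; lia.
Qed.

Lemma catalan_ratio m : m.+2 * catalan m.+1 = 2 * (2 * m).+1 * catalan m.
Proof.
apply/eqP; rewrite -(eqn_pmul2l (ltn0Sn m)); apply/eqP.
by rewrite mulnCA [in RHS]mulnCA !catalanE -bin_centralS mulnCA catalanE.
Qed.

Lemma catalan_gt0 m : 0 < catalan m.
Proof.
have := catalanE m; have : 0 < 'C(2 * m, m) by rewrite bin_gt0; lia.
by case: (catalan m) => // [] ; lia.
Qed.

(** The product [f i * f (n - i)] is invariant under reversal of the index, so the weight [i]
    averages to [n / 2]. *)
Lemma sum_index_convolution (f : nat -> nat) n :
  2 * \sum_(i < n.+1) i * (f i * f (n - i)) = n * \sum_(i < n.+1) f i * f (n - i).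
Proof.
rewrite mul2n -addnn {1}(reindex_inj rev_ord_inj) /= -big_split big_distrr /=.
apply: eq_bigr => i _; have := ltn_ord i => ?.
rewrite subSS (_ : n - (n - i) = i); last by lia.
by rewrite [f (n - i) * _]mulnC -mulnDl; congr (_ * _); lia.
Qed.

(** Derived from the two-term recurrence [catalan_ratio]. With [S n] the convolution, the sum
    weighted by [i.+1] is computed twice: by symmetry, and by shifting the index with
    [catalan_ratio]. This gives [(n + 3) S (n + 1) = 2 C_(n+1) + 4 (n + 1) S n], and the induction
    closes. *)
Lemma catalan_convolution n :
  \sum_(i < n.+1) catalan i * catalan (n - i) = catalan n.+1.
Proof.
elim: n => [|n IHn]; first by rewrite big_ord_recl big_ord0.
pose S n := \sum_(i < n.+1) catalan i * catalan (n - i).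
have h1 := sum_index_convolution catalan n.+1.
have h2 := sum_index_convolution catalan n.
have h3 : \sum_(i < n.+2) i.+1 * (catalan i * catalan (n.+1 - i)) =
   catalan n.+1 + \sum_(i < n.+1) (4 * i + 2) * (catalan i * catalan (n - i)).
  rewrite big_ord_recl /= mul1n mul1n subn0; congr (_ + _).
  apply: eq_bigr => i _; rewrite /bump /= add1n subSS mulnA catalan_ratio mulnA.
  by congr (_ * _ * _); lia.
have h4 : \sum_(i < n.+2) i.+1 * (catalan i * catalan (n.+1 - i)) =
    \sum_(i < n.+2) i * (catalan i * catalan (n.+1 - i)) + S n.+1.
  by rewrite -big_split /=; apply: eq_bigr => i _; rewrite mulSn addnC.
have h5 : \sum_(i < n.+1) (4 * i + 2) * (catalan i * catalan (n - i)) =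
    4 * \sum_(i < n.+1) i * (catalan i * catalan (n - i)) + 2 * S n.
  rewrite !big_distrr -big_split /=; apply: eq_bigr => i _.
  by rewrite mulnDl -mulnA.
rewrite -/(S n) in IHn h2; rewrite -/(S n.+1) in h1 *.
have := catalan_ratio n.+1; rewrite -IHn in h3 h4 h5 *; nia.
Qed.

(** Number of noncrossing perfect matchings of [s] points on a line. The value 0 at odd [s] keeps
    parity conditions out of the product formulas below. *)
Definition catpts s : nat := if odd s then 0 else catalan s./2.

Lemma catpts_odd s : odd s -> catpts s = 0. Proof. by rewrite /catpts => ->. Qed.

Lemma catpts_gt0 s : ~~ odd s -> 0 < catpts s.
Proof. by rewrite /catpts => /negbTE ->; apply: catalan_gt0. Qed.

Lemma catpts_double k : catpts (2 * k) = catalan k.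
Proof. by rewrite /catpts mul2n odd_double doubleK. Qed.

Lemma sum_even_support (f : nat -> nat) k : (forall i, odd i -> f i = 0) ->
  \sum_(i < (2 * k).+1) f i = \sum_(i < k.+1) f (2 * i).
Proof.
move=> f0; elim: k => [|k IHk]; first by rewrite !big_ord_recl !big_ord0.
rewrite (_ : (2 * k.+1).+1 = (2 * k).+3); last by lia.
rewrite !big_ord_recr /= in IHk *; rewrite IHk (f0 (2 * k).+1) ?addn0; last by lia.
by congr (_ + f _); lia.
Qed.

(** The Catalan recurrence in terms of points: [i] of them lie under the arc of the first point and
    [s - 2 - i] beyond it. For even [s] only even [i] contribute; for odd [s] one factor of each
    product vanishes. *)
Lemma catpts_convolution s : 0 < s ->
  \sum_(i < s.-1) catpts i * catpts (s - 2 - i) = catpts s.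
Proof.
case: s => // s _ /=; have [os|es] := boolP (odd s.+1).
  rewrite (catpts_odd os) big1 // => i _; have := ltn_ord i.
  have [oi|ei] := boolP (odd i); first by rewrite (catpts_odd oi).
  by move=> h; rewrite (@catpts_odd (_ - _)) ?muln0 //; lia.
have [k def_s] : exists k, s = (2 * k).+1 by exists s./2; lia.
rewrite def_s (sum_even_support k (f := fun i => catpts i * catpts ((2 * k).+2 - 2 - i))).
  rewrite (_ : (2 * k).+2 = 2 * k.+1); last by lia.
  rewrite catpts_double -catalan_convolution; apply: eq_bigr => i _.
  by rewrite catpts_double -[catalan (k - i)]catpts_double; congr (_ * catpts _); lia.
by move=> i oi; rewrite (catpts_odd oi).
Qed.

(** Ranking the elements of [P] is a bijection onto the indices below [#|P|]; the induction removes
    the largest element. It turns sums over the partner of a point into sums over the number of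
    points in between. *)
Lemma big_rank (T : Type) (idx : T) (op : Monoid.com_law idx) N
    (P : {set 'I_N}) (f : nat -> T) :
  \big[op/idx]_(y in P) f #|[set z in P | z < y]| = \big[op/idx]_(i < #|P|) f i.
Proof.
move: {2}#|P| (erefl #|P|) => k; elim: k P => [|k IHk] P cardP.
  by rewrite cardP big_ord0 big_pred0 // => y; rewrite (cards0_eq cardP) inE.
have [x0 x0P] : exists x, x \in P by apply/card_gt0P; rewrite cardP.
have [w wP maxw] := arg_maxnP (P := mem P) (fun x : 'I_N => x : nat) x0P.
have cardPw : #|P :\ w| = k by have := cardsD1 w P; rewrite [w \in P]wP cardP => -[].
have := IHk _ cardPw; rewrite cardPw => IH.
rewrite (bigD1 w) //= Monoid.mulmC cardP big_ord_recr /= -IH.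
have lew z : z \in P -> z <= w by apply: maxw.
congr (op _ (f _)); last first.
  rewrite -cardPw; apply: eq_card => z; rewrite !inE ltn_neqAle.
  by case: (boolP (z \in P)) => [/lew ->|]; rewrite ?andbF // !andbT.
apply: eq_big => [i|i /andP[iP _]]; first by rewrite !inE andbC.
congr f; apply: eq_card => z; rewrite !inE; case: eqP => // ->.
by rewrite ltnNge (lew i iP) andbF.
Qed.

(** * Counting noncrossing monochromatic matchings *)

Definition crossing N (m : {ffun 'I_N -> 'I_N}) (a b : 'I_N) : bool :=
  [&& a < b, b < m a & m a < m b].

(** [valid_pair] for an arbitrary type of colours, because [refine] enlarges the set of colours. *)
Definition ncmatching N (K : eqType) (c : 'I_N -> K) (m : {ffun 'I_N -> 'I_N}) :=
  [forall x, [&& m (m x) == x, m x != x & c (m x) == c x]] &&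
  [forall a, forall b, (c a == c b) ==> ~~ crossing m a b].

Lemma ncmatchingP N (K : eqType) (c : 'I_N -> K) (m : {ffun 'I_N -> 'I_N}) :
  reflect [/\ involutive m, forall x, m x != x, forall x, c (m x) = c x &
             forall a b, c a = c b -> ~~ crossing m a b]
          (ncmatching c m).
Proof.
apply: (iffP andP) => [[/forallP h1 /forallP h2]|[h1 h2 h3 h4]]; split.
- by move=> x; have /and3P[/eqP] := h1 x.
- by move=> x; have /and3P[_ ?] := h1 x.
- by move=> x; have /and3P[_ _ /eqP] := h1 x.
- by move=> a b /eqP cab; have /forallP/(_ b)/implyP/(_ cab) := h2 a.
- by apply/forallP => x; rewrite h1 h2 h3 !eqxx.
- by apply/forallP => a; apply/forallP => b; apply/implyP => /eqP /h4.
Qed.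

Definition arc_part : 'I_3 := @Ordinal 3 0 isT.
Definition in_part : 'I_3 := @Ordinal 3 1 isT.
Definition out_part : 'I_3 := @Ordinal 3 2 isT.

Definition arc_status N (x y z : 'I_N) : 'I_3 :=
  if (z == x) || (z == y) then arc_part else
  if (x < z) && (z < y) then in_part else out_part.

(** Only colours in [Q] are split into three; every other colour carries the dummy label [out_part],
    so its class does not change. *)
Definition refine N (K : eqType) (Q : pred K) (c : 'I_N -> K) (x y z : 'I_N) :=
  (c z, if Q (c z) then arc_status x y z else out_part).

Lemma arc_status_eqE N (x y z w : 'I_N) :
  arc_status x y z = arc_status x y w ->
  ((z == x :> nat) || (z == y :> nat)) = ((w == x :> nat) || (w == y :> nat)) /\
  ((x < z) && (z < y)) = ((x < w) && (w < y)).
Proof.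
rewrite /arc_status -!(inj_eq val_inj) /=.
by do 4?[case: ifP => ?] => //; lia.
Qed.

(* An arc that is crossed by no arc of a colour in [Q] splits those colours into
   the arc itself, its inside and its outside. *)
Lemma ncmatching_refine N (K : eqType) (Q : pred K) (c : 'I_N -> K) (x y : 'I_N)
    (m : {ffun 'I_N -> 'I_N}) :
  x < y -> Q (c x) -> c y = c x ->
  ncmatching (refine Q c x y) m =
  [&& ncmatching c m, m x == y &
      [forall z, Q (c z) ==> ~~ (crossing m x z || crossing m z x)]].
Proof.
move=> ltxy Qx cyx; apply/idP/idP.
  move=> /ncmatchingP[mK mN mc mX].
  have mc1 z : c (m z) = c z by case: (mc z).
  have mc2 z : Q (c z) -> arc_status x y (m z) = arc_status x y z.
    by move=> Qz; case: (mc z); rewrite mc1 Qz.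
  (* Only [x] and [y] have status [arc_part], and [m] has no fixed point. *)
  have mxy : m x = y.
    have := mc2 x Qx; rewrite {2}/arc_status eqxx /arc_status /=.
    by rewrite (negbTE (mN x)) /=; case: eqP => // _; case: ifP.
  apply/and3P; split; [|by rewrite mxy|].
  (* Both ends of an arc with colour in [Q] have the same status, and two such arcs can cross only
     if their statuses agree; then the refined colouring already forbids the crossing. *)
  - apply/ncmatchingP; split => // a b cab; apply/negP => crab.
    have := mX a b; rewrite crab /refine -cab; case: ifP => Qa; last by move=> /(_ erefl).
    have Qb : Q (c b) by rewrite -cab.
    have [a1 a2] := arc_status_eqE (mc2 a Qa).
    have [b1 b2] := arc_status_eqE (mc2 b Qb).
    case/and3P: crab => ? ? ? h; suff: false by []; apply: h; congr (_, _).
    rewrite /arc_status -!(inj_eq val_inj) /=; move: a1 a2 b1 b2.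
    by do 4?[case: ifP => ?] => //; lia.
  - apply/forallP => z; apply/implyP => Qz; apply/negP.
    have [z1 z2] := arc_status_eqE (mc2 z Qz); rewrite /crossing mxy; lia.
case/and3P => /ncmatchingP[mK mN mc mX] /eqP mxy /forallP iso.
have myx : m y = x by rewrite -mxy mK.
(* A point of []x, y[] whose partner lay outside would give an arc crossing the arc from [x] to
   [y]. *)
have in_in z : Q (c z) -> x < z -> z < y -> (x < m z) && (m z < y).
  move=> Qz xz zy; have Qmz : Q (c (m z)) by rewrite mc.
  have /implyP/(_ Qz) := iso z; have /implyP/(_ Qmz) := iso (m z).
  rewrite /crossing mxy mK.
  have : m z != x :> nat by apply/eqP => /val_inj h; move: zy; rewrite -[z]mK h mxy ltnn.
  have : m z != y :> nat by apply/eqP => /val_inj h; move: xz; rewrite -[z]mK h myx ltnn.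
  lia.
apply/ncmatchingP; split => //.
  move=> z; rewrite /refine mc; case: ifP => // Qz; congr (_, _).
  have Qmz : Q (c (m z)) by rewrite mc.
  rewrite /arc_status.
  have -> : (m z == x) = (z == y) by rewrite -myx (inj_eq (can_inj mK)).
  have -> : (m z == y) = (z == x) by rewrite -mxy (inj_eq (can_inj mK)).
  rewrite orbC; case: ifP => // _.
  have -> // : (x < m z) && (m z < y) = (x < z) && (z < y).
  by apply/idP/idP => /andP[h1 h2]; have := in_in _ _ h1 h2; rewrite ?mK; apply.
by move=> a b [cab _]; apply: mX.
Qed.

Definition class_in N (K : eqType) (c : 'I_N -> K) (t : K) (x y : 'I_N) : nat :=
  #|[set z | [&& c z == t, x < z & z < y]]|.

Definition class_out N (K : eqType) (c : 'I_N -> K) (t : K) (x y : 'I_N) : nat :=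
  #|[set z | (c z == t) && ((z < x) || (y < z))]|.

Definition class N (K : eqType) (c : 'I_N -> K) (t : K) : nat := #|[set z | c z == t]|.

Lemma prod_parts (f : 'I_3 -> nat) :
  \prod_s f s = f arc_part * f in_part * f out_part.
Proof.
rewrite !big_ord_recl big_ord0 muln1 mulnA.
by congr (f _ * f _ * f _); apply: val_inj.
Qed.

Lemma class_refine_arc N (K : eqType) (Q : pred K) (c : 'I_N -> K) (x y : 'I_N) t :
  x < y -> Q (c x) -> c y = c x ->
  class (refine Q c x y) (t, arc_part) = (if t == c x then 2 else 0).
Proof.
move=> ltxy Qx cyx.
have eqA z : (refine Q c x y z == (t, arc_part)) = (t == c x) && (z \in [set x; y]).
  rewrite /refine xpair_eqE !inE /arc_status.
  case: (eqVneq z x) => [->|_]; first by rewrite Qx eqxx /= !andbT eq_sym.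
  case: (eqVneq z y) => [->|_]; first by rewrite cyx Qx eqxx /= !andbT eq_sym.
  by rewrite andbF /=; case: (Q _); last rewrite andbF //; case: ifP; rewrite andbF.
case: eqP => tx; last by apply: eq_card0 => z; rewrite inE eqA; case: eqP.
have neq : x != y by apply/eqP => xy; move: ltxy; rewrite xy ltnn.
transitivity #|[set x; y]|; last by rewrite cards2 neq.
by apply: eq_card => z; rewrite inE eqA tx eqxx.
Qed.

Lemma class_refine_in N (K : eqType) (Q : pred K) (c : 'I_N -> K) (x y : 'I_N) t :
  class (refine Q c x y) (t, in_part) = if Q t then class_in c t x y else 0.
Proof.
case: ifP => Qt; last first.
  apply: eq_card0 => z; rewrite !inE xpair_eqE.
  by apply/negP => /andP[/eqP ->]; rewrite Qt.
apply: eq_card => z; rewrite !inE xpair_eqE; case: eqP => //= ->; rewrite Qt /arc_status.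
case: (eqVneq z x) => [->|_]; first by rewrite ltnn.
case: (eqVneq z y) => [->|_]; first by rewrite ltnn andbF.
by case: ifP.
Qed.

Lemma class_refine_out N (K : eqType) (Q : pred K) (c : 'I_N -> K) (x y : 'I_N) t :
  x < y ->
  class (refine Q c x y) (t, out_part) = if Q t then class_out c t x y else class c t.
Proof.
move=> ltxy; case: ifP => Qt; apply: eq_card => z; rewrite !inE xpair_eqE;
  case: eqP => //= ->; rewrite Qt ?eqxx // /arc_status.
case: (eqVneq z x) => [->|]; first by rewrite /= ltnn ltnNge (ltnW ltxy).
case: (eqVneq z y) => [->|]; first by rewrite orbT /= ltnn orbF ltnNge (ltnW ltxy).
by rewrite -!(inj_eq val_inj) => h1 h2; case: ifP; move: h1 h2 => /=; lia.
Qed.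

(** The class of the arc itself has 2 points or none, and both values of [catpts] are 1. *)
Lemma prod_class_refine N (K : finType) (Q : pred K) (c : 'I_N -> K) (x y : 'I_N) :
  x < y -> Q (c x) -> c y = c x ->
  \prod_t catpts (class (refine Q c x y) t) =
  \prod_t (if Q t then catpts (class_in c t x y) * catpts (class_out c t x y)
           else catpts (class c t)).
Proof.
move=> ltxy Qx cyx.
rewrite -(pair_bigA _ (fun t s => catpts (class (refine Q c x y) (t, s)))) /=.
apply: eq_bigr => t _.
rewrite prod_parts class_refine_arc // class_refine_in class_refine_out //.
have -> : catpts (if t == c x then 2 else 0) = 1 by case: ifP.
by case: ifP; rewrite !mul1n.
Qed.

(** Each point has exactly one possible partner, and a monochromatic crossing would need four points
    of one colour. *)
Lemma card_ncmatching_small N (K : eqType) (c : 'I_N -> K) :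
  (forall t, class c t = 0 \/ class c t = 2) -> #|[set m | ncmatching c m]| = 1.
Proof.
move=> c02; pose oth x z := (z != x) && (c z == c x).
have othU x : exists2 z, oth x z & forall w, oth x w -> w = z.
  have xin : x \in [set z | c z == c x] by rewrite inE.
  have : #|[set z | c z == c x] :\ x| = 1.
    have := cardsD1 x [set z | c z == c x]; rewrite xin.
    by case: (c02 (c x)); rewrite /class => ->; lia.
  move=> /eqP/cards1P[z defz]; exists z; first by have := set11 z; rewrite -defz !inE.
  by move=> w ow; apply/eqP; rewrite -in_set1 -defz !inE.
pose m0 := [ffun x => odflt x [pick z | oth x z]].
have m0P x : oth x (m0 x).
  rewrite ffunE; case: pickP => //= no; have [z] := othU x; by rewrite no.
have m0U x w : oth x w -> w = m0 x.
  by have [z _ zU] := othU x => /zU ->; rewrite (zU _ (m0P x)).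
apply/eqP/cards1P; exists m0; apply/setP => m; rewrite !inE.
apply/idP/eqP => [/ncmatchingP[mK mN mc _]|->].
  by apply/ffunP => x; apply: m0U; rewrite /oth mN mc eqxx.
apply/ncmatchingP; split.
- move=> x; apply/esym/m0U; have /andP[h1 h2] := m0P x.
  by rewrite /oth eq_sym h1 eq_sym.
- by move=> x; have /andP[] := m0P x.
- by move=> x; have /andP[_ /eqP] := m0P x.
- move=> a b cab; apply/negP => /and3P[ab]; rewrite -(m0U a b) ?ltnn //.
  by rewrite /oth cab eqxx -(inj_eq val_inj) /= gtn_eqF.
Qed.

Lemma class_out_subn N (K : eqType) (c : 'I_N -> K) (x y : 'I_N) t :
  x < y -> c x = t -> c y = t ->
  class_out c t x y = class c t - 2 - class_in c t x y.
Proof.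
move=> ltxy cx cy; rewrite /class /class_in /class_out.
have neq : x != y by apply/eqP => xy; move: ltxy; rewrite xy ltnn.
set A := [set z | c z == t]; set B := finset _; set C := [set z | _ & _].
have -> : A = [set x; y] :|: (C :|: B).
  apply/setP => z; rewrite !inE.
  case: (eqVneq z x) => [->|]; first by rewrite cx eqxx.
  case: (eqVneq z y) => [->|]; first by rewrite cy eqxx.
  by rewrite -!(inj_eq val_inj) /= => h1 h2; case: (c z == t) => //=; lia.
rewrite cardsU cards2 neq.
have -> : [set x; y] :&: (C :|: B) = set0.
  apply/setP => z; rewrite !inE; case: (eqVneq z x) => [->|]; first by rewrite ltnn; lia.
  by case: (eqVneq z y) => [->|//]; rewrite ltnn; lia.
rewrite cardsU; have -> : C :&: B = set0 by apply/setP => z; rewrite !inE; case: eqP => //= _; lia.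
by rewrite !cards0; lia.
Qed.

(** Arcs of colour [c x] never cross the arc from [x] to [y], so fixing this arc amounts to refining
    that single colour. *)
Lemma card_ncmatching_arc N (K : eqType) (c : 'I_N -> K) (x y : 'I_N) :
  x < y -> c y = c x ->
  #|[set m : {ffun 'I_N -> 'I_N} | ncmatching c m && (m x == y)]| =
  #|[set m | ncmatching (refine (pred1 (c x)) c x y) m]|.
Proof.
move=> ltxy cyx; have Qx : pred1 (c x) (c x) by rewrite /= eqxx.
apply: eq_card => m; rewrite !inE (ncmatching_refine m ltxy Qx cyx).
case: (boolP (ncmatching c m)) => //= /ncmatchingP[mK mN mc mX].
case: eqP => //= mxy; apply/esym/forallP => z; apply/implyP => /eqP cz.
by rewrite negb_or !mX.
Qed.

(** Induction on the number of monochromatic pairs of points. In a class of size neither 0 nor 2,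
    the matchings are sorted by the partner [y] of the least point [x]; refining this colour alone
    leaves fewer monochromatic pairs, and summation over [y] is [catpts_convolution]. *)
Theorem card_ncmatching N (K : finType) (c : 'I_N -> K) :
  #|[set m | ncmatching c m]| = \prod_t catpts (class c t).
Proof.
have [k] := ubnP #|[set p : 'I_N * 'I_N | c p.1 == c p.2]|.
elim: k K c => // k IHk K c lek.
have [/existsP[t /andP[t0 t2]]|] :=
    boolP [exists t, (class c t != 0) && (class c t != 2)]; last first.
  rewrite negb_exists => /forallP small; rewrite card_ncmatching_small; last first.
    by move=> t; have := small t; lia.
  rewrite big1 // => t _; have := small t; rewrite negb_and !negbK.
  by case/orP => /eqP ->.
have [x0 x0P] : exists x, x \in [set z | c z == t] by apply/card_gt0P; rewrite lt0n.
have [x xP minx] := arg_minnP (P := mem [set z | c z == t]) (fun x : 'I_N => x : nat) x0P.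
have /eqP cx : c x == t by move: xP; rewrite /= inE.
have lex z : c z = t -> x <= z by move=> cz; apply: minx; rewrite /= inE cz.
pose P := [set z | c z == t] :\ x.
have cardP : class c t = #|P|.+1.
  by rewrite /class (cardsD1 x) inE cx eqxx.
rewrite -sum1_card (partition_big (fun m : {ffun 'I_N -> 'I_N} => m x) (mem P)) /=; last first.
  move=> m; rewrite inE => /ncmatchingP[_ mN mc _].
  by rewrite !inE mN mc cx eqxx.
have ltP y : y \in P -> x < y /\ c y = c x.
  rewrite !inE => /andP[yx /eqP cy]; split; last by rewrite cy.
  by rewrite ltn_neqAle lex // andbT -(inj_eq val_inj) eq_sym in yx *.
have term y : y \in P ->
    \sum_(m | (m \in [set m | ncmatching c m]) && (m x == y)) 1 =
    (\prod_(u | u != t) catpts (class c u)) *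
    (catpts #|[set z in P | z < y]| * catpts (class c t - 2 - #|[set z in P | z < y]|)).
  move=> yP; have [ltxy cyx] := ltP y yP.
  have in_y : class_in c t x y = #|[set z in P | z < y]|.
    apply: eq_card => z; rewrite !inE; case: eqP => [/lex lez|_]; last by rewrite andbF.
    by rewrite -(inj_eq val_inj) /=; lia.
  transitivity #|[set m : {ffun 'I_N -> 'I_N} | ncmatching c m && (m x == y)]|.
    by rewrite sum1dep_card; apply: eq_card => m; rewrite !inE.
  rewrite card_ncmatching_arc // IHk; last first.
    rewrite ltnS in lek; apply: leq_trans lek; apply: proper_card; apply/properP; split.
      by apply/subsetP => -[z w]; rewrite !inE /= /refine xpair_eqE => /andP[].
    (* A third point [z] of the colour: the pair [(x, z)] is monochromatic for [c] but no longer
       after refinement, so the measure drops. *)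
    have [z zP] : exists z, z \in P :\ y.
      apply/card_gt0P; have := cardsD1 y P; rewrite yP; move: t0 t2; lia.
    exists (x, z); move: zP; rewrite !inE /= cx => /and3P[zy zx /eqP cz].
      by rewrite cz.
    rewrite /refine cx cz /= eqxx /arc_status eqxx (negbTE zx) (negbTE zy) /=.
    by rewrite xpair_eqE eqxx; case: ifP.
  rewrite prod_class_refine //; last by rewrite /= eqxx.
  rewrite (bigD1 t) //= cx eqxx class_out_subn ?cx ?cyx // in_y mulnC.
  by congr (_ * _); apply: eq_bigr => u /negbTE ->.
rewrite (eq_bigr _ term) -big_distrr /=.
rewrite (big_rank _ P (fun i => catpts i * catpts (class c t - 2 - i))).
rewrite [in RHS](bigD1 t) //= mulnC; congr (_ * _).
by rewrite -(catpts_convolution (s := class c t)) ?cardP.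
Qed.

Definition iso_arc N (m : {ffun 'I_N -> 'I_N}) (x y : 'I_N) : bool :=
  (m x == y) && [forall z, ~~ (crossing m x z || crossing m z x)].

Lemma ncmatching_iso_arc N (K : eqType) (c : 'I_N -> K) (x y : 'I_N)
    (m : {ffun 'I_N -> 'I_N}) : x < y -> c y = c x ->
  ncmatching (refine predT c x y) m = ncmatching c m && iso_arc m x y.
Proof.
by move=> ltxy cyx; rewrite ncmatching_refine.
Qed.

Lemma class_split N (K : eqType) (c : 'I_N -> K) (x y : 'I_N) t :
  x < y -> c y = c x ->
  class c t = 2 * (c x == t) + class_in c t x y + class_out c t x y.
Proof.
move=> ltxy cyx; have Qx : predT (c x) by [].
have := class_refine_arc t ltxy Qx cyx.
have := class_refine_in predT c x y t.
have /= <- := class_refine_out predT c t ltxy => /= <-.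
rewrite eq_sym; have -> : (if c x == t then 2 else 0) = 2 * (c x == t) by case: eqP.
move=> <-; rewrite /class -!sum1dep_card.
rewrite (partition_big (fun z => (refine predT c x y z).2) predT) //=.
rewrite !big_ord_recl big_ord0 addn0 addnA.
by congr (_ + _ + _); apply: eq_bigl => z; rewrite xpair_eqE.
Qed.

Lemma card_arc_matching N (K : finType) (c : 'I_N -> K) (x y : 'I_N) :
  x < y ->
  #|[set m : {ffun 'I_N -> 'I_N} | ncmatching c m && (m x == y)]| =
  (c y == c x) * (catpts (class_in c (c x) x y) * catpts (class_out c (c x) x y) *
    \prod_(t | t != c x) catpts (class c t)).
Proof.
move=> ltxy; case: eqP => [cyx|cyx]; last first.
  rewrite mul0n; apply: eq_card0 => m; rewrite inE.
  by apply/negP => /andP[/ncmatchingP[_ _ mc _] /eqP mxy]; case: cyx; rewrite -mxy mc.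
rewrite mul1n card_ncmatching_arc // card_ncmatching prod_class_refine //=.
by rewrite (bigD1 (c x)) //= eqxx; congr (_ * _); apply: eq_bigr => t /negbTE ->.
Qed.

Lemma card_iso_arc N (K : finType) (c : 'I_N -> K) (x y : 'I_N) :
  x < y ->
  #|[set m : {ffun 'I_N -> 'I_N} | ncmatching c m && iso_arc m x y]| =
  (c y == c x) *
  \prod_t (catpts (class_in c t x y) * catpts (class_out c t x y)).
Proof.
move=> ltxy; case: eqP => [cyx|cyx]; last first.
  rewrite mul0n; apply: eq_card0 => m; rewrite inE /iso_arc.
  by apply/negP => /and3P[/ncmatchingP[_ _ mc _] /eqP mxy]; case: cyx; rewrite -mxy mc.
rewrite mul1n -(prod_class_refine (Q := predT)) // -card_ncmatching.
by apply: eq_card => m; rewrite !inE ncmatching_iso_arc.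
Qed.

(** * Two disjoint isolated arcs *)

Definition class_out2 N (K : eqType) (c : 'I_N -> K) (t : K) (x y x' y' : 'I_N) : nat :=
  #|[set z | [&& c z == t, (z < x) || (y < z) & (z < x') || (y' < z)]]|.

Lemma class_refineT N (K : eqType) (c : 'I_N -> K) (x y : 'I_N) t s (P : pred 'I_N) :
  #|[set z | (refine predT c x y z == (t, s)) && P z]| =
  #|[set z | [&& c z == t, arc_status x y z == s & P z]]|.
Proof. by apply: eq_card => z; rewrite !inE xpair_eqE andbA. Qed.

(** The colouring is refined twice, in every colour: first by the arc on the left, then by the one
    on the right. *)
Lemma card_iso_arc2 N (K : finType) (c : 'I_N -> K) (x y x' y' : 'I_N) :
  x < y -> y < x' -> x' < y' ->
  #|[set m : {ffun 'I_N -> 'I_N} | [&& ncmatching c m, iso_arc m x y & iso_arc m x' y']]| =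
  (c y == c x) * (c y' == c x') *
  \prod_t (catpts (class_in c t x y) * catpts (class_in c t x' y') *
           catpts (class_out2 c t x y x' y')).
Proof.
move=> ltxy ltyx' ltxy'.
have none (u v : 'I_N) : c v <> c u ->
    forall m : {ffun 'I_N -> 'I_N}, ncmatching c m -> iso_arc m u v -> false.
  move=> cuv m /ncmatchingP[_ _ mc _] /andP[/eqP muv _].
  by case: cuv; rewrite -muv mc.
case: eqP => [cyx|cyx]; last first.
  by apply: eq_card0 => m; rewrite inE; apply/negP => /and3P[h1 h2 _]; have := none _ _ cyx _ h1 h2.
case: eqP => [cyx'|cyx']; last first.
  by apply: eq_card0 => m; rewrite inE; apply/negP => /and3P[h1 _ h2]; have := none _ _ cyx' _ h1 h2.
have out_status (z : 'I_N) : y < z -> arc_status x y z = out_part.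
  by move=> yz; rewrite /arc_status -!(inj_eq val_inj) /=; do 2?[case: ifP => ?] => //; lia.
have c1 : refine predT c x y y' = refine predT c x y x'.
  by rewrite /refine cyx' !out_status //; lia.
rewrite !mul1n; transitivity
    (#|[set m | ncmatching (refine predT (refine predT c x y) x' y') m]|).
  by apply: eq_card => m; rewrite !inE !ncmatching_iso_arc // andbA.
rewrite card_ncmatching prod_class_refine //=.
rewrite -(pair_bigA _ (fun t s => catpts (class_in (refine predT c x y) (t, s) x' y')
    * catpts (class_out (refine predT c x y) (t, s) x' y'))) /=.
apply: eq_bigr => t _; rewrite prod_parts /class_in /class_out !class_refineT.
(* The second interval lies beyond [y], so it meets only the outside part of the first arc. *)
have in0 s : s != out_part ->
    #|[set z : 'I_N | [&& c z == t, arc_status x y z == s, x' < z & z < y']]| = 0.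
  move=> so; apply: eq_card0 => z; rewrite !inE; apply/negP => /and4P[_ /eqP zs lez _].
  by move: so; rewrite -zs out_status ?eqxx //; lia.
rewrite (in0 arc_part) // (in0 in_part) // (_ : catpts 0 = 1) // !mul1n.
set A1 := catpts #|_|.
have -> : A1 = catpts (class (refine predT c x y) (t, arc_part)).
  congr catpts; apply: eq_card => z; rewrite !inE xpair_eqE; congr (_ && _).
  case: eqP => // /eqP; rewrite /arc_status -!(inj_eq val_inj) /=.
  by case: ifP => [|_]; [lia | case: ifP].
rewrite class_refine_arc //; have -> : catpts (if t == c x then 2 else 0) = 1 by case: ifP.
rewrite mul1n mulnA; congr (catpts _ * catpts _ * catpts _).
- by apply: eq_card => z; rewrite !inE; case: (c z == t) => //=;
    rewrite /arc_status -!(inj_eq val_inj) /=; do 2?[case: ifP => ?]; move=> /=; lia.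
- by apply: eq_card => z; rewrite !inE; case: (c z == t) => //=;
    rewrite /arc_status -!(inj_eq val_inj) /=; do 2?[case: ifP => ?]; move=> /=; lia.
- by apply: eq_card => z; rewrite !inE; case: (c z == t) => //=;
    rewrite /arc_status -!(inj_eq val_inj) /=; do 2?[case: ifP => ?]; move=> /=; lia.
Qed.

Lemma class_split2 N (K : eqType) (c : 'I_N -> K) (x y x' y' : 'I_N) t :
  x < y -> y < x' -> x' < y' -> c y = c x -> c y' = c x' ->
  class c t = (2 * (c x == t) + class_in c t x y) +
              (2 * (c x' == t) + class_in c t x' y') + class_out2 c t x y x' y'.
Proof.
move=> ltxy ltyx' ltxy' cyx cyx'; rewrite (class_split t ltxy cyx) -[RHS]addnA.
congr (_ + _).
have outx (z : 'I_N) : y < z -> refine predT c x y z = (c z, out_part).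
  move=> yz; rewrite /refine /arc_status -!(inj_eq val_inj) /=.
  by do 2?[case: ifP => ?] => //; lia.
have /= <- := class_refine_out predT c t ltxy.
rewrite (@class_split _ _ _ x' y') //; last by rewrite !outx ?cyx' //; lia.
rewrite outx // xpair_eqE eqxx andbT; congr (_ + _ + _).
- rewrite /class_in (class_refineT c x y t out_part (fun z => (x' < z) && (z < y'))).
  apply: eq_card => z; rewrite !inE; case: (c z == t) => //=.
  by rewrite /arc_status -!(inj_eq val_inj) /=; do 2?[case: ifP => ?]; move=> /=; lia.
- rewrite /class_out (class_refineT c x y t out_part (fun z => (z < x') || (y' < z))).
  apply: eq_card => z; rewrite !inE; case: (c z == t) => //=.
  by rewrite /arc_status -!(inj_eq val_inj) /=; do 2?[case: ifP => ?]; move=> /=; lia.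
Qed.

Lemma catalanS_leq m : catalan m.+1 <= 4 * catalan m.
Proof. by have := catalan_ratio m; nia. Qed.

Lemma catpts_half v u : ~~ odd v -> ~~ odd u ->
  catpts v = catalan v./2 /\ catpts (v + u) = catalan (v./2 + u./2).
Proof.
by move=> ev eu; rewrite /catpts oddD (negbTE ev) (negbTE eu) /=; split=> //;
  congr catalan; lia.
Qed.

(** Consecutive Catalan numbers have ratio at most 4 and an arc uses two points, hence a factor 2
    per added point. *)
Lemma catpts_addn_le v u : ~~ odd u -> catpts (v + u) <= 2 ^ u * catpts v.
Proof.
move=> eu; have [ov|ev] := boolP (odd v); first by rewrite (@catpts_odd (v + u)) //; lia.
have [-> ->] := catpts_half ev eu.
have -> : 2 ^ u = 4 ^ u./2 by rewrite -(expnM 2 2); congr (2 ^ _); lia.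
elim: u./2 => [|k IHk]; first by rewrite addn0 mul1n.
rewrite addnS expnS -mulnA; apply: leq_trans (catalanS_leq _) _.
by rewrite leq_mul2l IHk.
Qed.

Lemma big_ord_interval (T : Type) (idx : T) (op : Monoid.law idx) N a b (F : nat -> T) :
  \big[op/idx]_(y < N | (a <= y) && (y < b)) F y =
  \big[op/idx]_(a <= y < minn b N) F y.
Proof.
rewrite (big_nat_widenl a 0) // (big_nat_widen 0 (minn b N) N) ?geq_minr //.
rewrite big_mkord; apply: eq_bigl => y /=.
by rewrite leq_min ltn_ord andbT.
Qed.

Lemma card_ord_interval N a b :
  #|[set z : 'I_N | (a <= z) && (z < b)]| = minn b N - a.
Proof.
by rewrite -sum1dep_card (big_ord_interval _ N a b (fun=> 1)) sum_nat_const_nat muln1.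
Qed.

Import Order.TTheory GRing.Theory Num.Theory.
Local Open Scope ring_scope.

(** * Averages over colourings *)

Lemma leq_bin2 n m : ('C(n, m) <= 2 ^ n)%N.
Proof.
elim: n m => [|n IHn] [|m]; rewrite ?bin0 ?expn_gt0 //.
by rewrite binS expnS mul2n -addnn leq_add.
Qed.

Section ColouringAverages.
Variables (R : realFieldType) (N : nat).
Implicit Types (g : {ffun 'I_N -> bool} -> R) (c d : {ffun 'I_N -> bool}).

Definition evenc c := ~~ odd (class c true).

Definition avgc g : R := 2 ^- N * \sum_c g c.
(** For positive [N] exactly half of the colourings are even, whence the exponent [N.-1]. *)
Definition avge g : R := 2 ^- N.-1 * \sum_(c | evenc c) g c.

Definition flip (z : 'I_N) c : {ffun 'I_N -> bool} := [ffun w => (w == z) (+) c w].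

Lemma flipK z : involutive (flip z).
Proof. by move=> c; apply/ffunP => w; rewrite !ffunE addbA addbb. Qed.

Lemma flip_neq z c w : w != z -> flip z c w = c w.
Proof. by rewrite ffunE => /negbTE ->. Qed.

Lemma flip_eq z c : flip z c z = ~~ c z.
Proof. by rewrite ffunE eqxx. Qed.

Lemma pow2_neq0 k : 2 ^+ k != 0 :> R.
Proof. by rewrite expf_neq0 // pnatr_eq0. Qed.

Lemma pow2_gt0 k : 0 < 2 ^+ k :> R.
Proof. by rewrite exprn_gt0 // ltr0n. Qed.

Lemma avgc_flip z g : avgc (fun c => g (flip z c)) = avgc g.
Proof. by rewrite /avgc [in RHS](reindex_inj (can_inj (flipK z))). Qed.

Lemma eq_avgc g1 g2 : g1 =1 g2 -> avgc g1 = avgc g2.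
Proof. by move=> eg; congr (_ * _); apply: eq_bigr. Qed.

Lemma avgcD g1 g2 : avgc (fun c => g1 c + g2 c) = avgc g1 + avgc g2.
Proof. by rewrite /avgc big_split mulrDr. Qed.

Lemma avgcZ a g : avgc (fun c => a * g c) = a * avgc g.
Proof. by rewrite /avgc -mulr_sumr mulrCA. Qed.

Lemma avgc1 : avgc (fun=> 1) = 1.
Proof.
rewrite /avgc sumr_const card_ffun card_bool card_ord natrX.
by rewrite mulVf // pow2_neq0.
Qed.

Lemma avgeD g1 g2 : avge (fun c => g1 c + g2 c) = avge g1 + avge g2.
Proof. by rewrite /avge big_split mulrDr. Qed.

Lemma avgeZ a g : avge (fun c => a * g c) = a * avge g.
Proof. by rewrite /avge -mulr_sumr mulrCA. Qed.

Lemma ler_avge g1 g2 : (forall c, evenc c -> g1 c <= g2 c) -> avge g1 <= avge g2.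
Proof.
move=> le; rewrite ler_wpM2l ?ler_sum //.
by rewrite invr_ge0 ltW // pow2_gt0.
Qed.

(** Lets the probability of a rare event be estimated without the parity condition, at the cost of a
    factor 2. *)
Lemma avge_le_avgc g : (forall c, 0 <= g c) -> avge g <= 2 * avgc g.
Proof.
move=> g0; rewrite /avge /avgc [X in _ <= 2 * (_ * X)](bigID evenc) /=.
have s0 : 0 <= \sum_(c | ~~ evenc c) g c by apply: sumr_ge0.
have s1 : 0 <= \sum_(c | evenc c) g c by apply: sumr_ge0.
have : 2 ^- N.-1 <= 2 * 2 ^- N :> R.
  case: (N) => [|k] /=; first by rewrite expr0 invr1; lra.
  by rewrite exprS invfM mulrA divff ?mul1r ?pnatr_eq0.
have : 0 <= 2 ^- N :> R by rewrite invr_ge0 ltW // pow2_gt0.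
nra.
Qed.

Lemma evenc_flip z c : evenc (flip z c) = ~~ evenc c.
Proof.
rewrite /evenc /class (cardsD1 z) [in RHS](cardsD1 z) !inE flip_eq.
have -> : [set w | flip z c w == true] :\ z = [set w | c w == true] :\ z.
  by apply/setP => w; rewrite !inE; case: eqP => //= /eqP /flip_neq ->.
by rewrite !oddD; case: (c z) => /=; case: (odd #|_|).
Qed.

(* Flipping a point on which [g] does not depend exchanges even and odd colourings. *)
Lemma avge_free z g : (forall c, g (flip z c) = g c) -> avge g = avgc g.
Proof.
move=> gz; rewrite /avge /avgc [in RHS](bigID evenc) /=.
have -> : \sum_(c | ~~ evenc c) g c = \sum_(c | evenc c) g c.
  rewrite (reindex_inj (can_inj (flipK z))); apply: eq_big => [c|c _ //].
  by rewrite evenc_flip negbK.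
have N0 : (0 < N)%N by apply: leq_trans (ltn_ord z).
have -> : 2 ^- N = 2^-1 * 2 ^- N.-1 :> R by rewrite -invfM -exprS (prednK N0).
by field; rewrite pow2_neq0.
Qed.

Lemma avge1 : (0 < N)%N -> avge (fun=> 1) = 1.
Proof. by move=> N0; rewrite (@avge_free (Ordinal N0)) // avgc1. Qed.

(* Exchanging the restrictions of a pair of colourings to [A] is an involution. *)
Lemma avgc_indep (A : pred 'I_N) g1 g2 :
  (forall c d, {in A, c =1 d} -> g1 c = g1 d) ->
  (forall c d, {in predC A, c =1 d} -> g2 c = g2 d) ->
  avgc (fun c => g1 c * g2 c) = avgc g1 * avgc g2.
Proof.
move=> g1A g2A.
pose mix c d := [ffun z => if A z then c z else d z] : {ffun 'I_N -> bool}.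
pose sw (p : {ffun 'I_N -> bool} * {ffun 'I_N -> bool}) := (mix p.1 p.2, mix p.2 p.1).
have swK : involutive sw.
  by move=> [c d]; congr (_, _); apply/ffunP => z; rewrite !ffunE; case: (A z).
have -> : avgc g1 * avgc g2 = 2 ^- N * 2 ^- N * \sum_p g1 p.1 * g2 p.2.
  rewrite /avgc mulrACA; congr (_ * _); rewrite mulr_suml.
  under eq_bigr do rewrite mulr_sumr.
  by rewrite (pair_bigA _ (fun c d => g1 c * g2 d)).
rewrite (reindex_inj (can_inj swK)) /=.
have -> : \sum_(p : {ffun 'I_N -> bool} * {ffun 'I_N -> bool})
     g1 (mix p.1 p.2) * g2 (mix p.2 p.1) = \sum_p (fun c d => g1 c * g2 c) p.1 p.2.
  apply: eq_bigr => -[c d] _ /=; congr (_ * _).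
    by apply: g1A => z zA; rewrite ffunE (zA : A z).
  by apply: g2A => z zA; rewrite ffunE (negbTE (zA : ~~ A z)).
rewrite -(pair_bigA _ (fun c d => g1 c * g2 c)) /=.
under eq_bigr do rewrite sumr_const card_ffun card_bool card_ord -[_ *+ _]mulr_natl natrX.
by rewrite -mulr_sumr mulrA mulrVK // unitfE pow2_neq0.
Qed.

Definition count_in (S : {set 'I_N}) (t : bool) c : nat := #|[set z in S | c z == t]|.

(** The number of points of a given colour in [S] is binomial. The induction conditions on one point
    by pairing [c] with [flip z c] and then uses Pascal's rule. *)
Lemma avgc_count (S : {set 'I_N}) t (phi : nat -> R) :
  avgc (fun c => phi (count_in S t c)) =
  2 ^- #|S| * \sum_(a < #|S|.+1) 'C(#|S|, a)%:R * phi a.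
Proof.
suff gen s : forall (T : {set 'I_N}) phi', #|T| = s ->
    avgc (fun c => phi' (count_in T t c)) =
    2 ^- s * \sum_(a < s.+1) 'C(s, a)%:R * phi' a by exact: gen.
elim: s {S phi} => [|s IHs] S phi cardS.
  rewrite big_ord_recl big_ord0 addr0 bin0 expr0 invr1 !mul1r.
  rewrite -[RHS]mulr1 -avgc1 -avgcZ; apply: eq_avgc => c; rewrite mulr1; congr phi.
  by apply: eq_card0 => z; rewrite (cards0_eq cardS) !inE.
have [z zS] : exists z, z \in S by apply/card_gt0P; rewrite cardS.
have cardSz : #|S :\ z| = s by have := cardsD1 z S; rewrite zS cardS => -[].
have cz c : count_in S t c = ((c z == t) + count_in (S :\ z) t c)%N.
  rewrite /count_in (cardsD1 z) !inE zS; congr (_ + _)%N.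
  by apply: eq_card => w; rewrite !inE andbA.
have cf c : count_in (S :\ z) t (flip z c) = count_in (S :\ z) t c.
  by apply: eq_card => w; rewrite !inE; case: eqP => //= /eqP /flip_neq ->.
have -> : avgc (fun c => phi (count_in S t c)) = 2^-1 *
   (avgc (fun c => phi (count_in (S :\ z) t c)) +
    avgc (fun c => phi (count_in (S :\ z) t c).+1)).
  rewrite -avgcD; set X := avgc _.
  have -> : X = 2^-1 * (X + X) by field.
  congr (_ * _); rewrite /X -{2}(avgc_flip z) -avgcD; apply: eq_avgc => c.
  by rewrite !cz cf flip_eq; case: (c z); case: (t) => //=; rewrite addrC.
rewrite (IHs _ _ cardSz) (IHs _ (fun a => phi a.+1) cardSz).
rewrite -mulrDr mulrA -invfM -exprS; congr (_ * _).
rewrite [in RHS]big_ord_recl bin0 /=.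
have -> : \sum_(i < s.+1) 'C(s.+1, bump 0 i)%:R * phi (bump 0 i) =
   \sum_(i < s.+1) 'C(s, i.+1)%:R * phi i.+1 + \sum_(i < s.+1) 'C(s, i)%:R * phi i.+1.
  by rewrite -big_split; apply: eq_bigr => i _; rewrite /bump /= add1n binS natrD mulrDl.
rewrite addrA; congr (_ + _).
rewrite big_ord_recl bin0 /= [in RHS]big_ord_recr /= bin_small // mul0r addr0.
by congr (_ + _); apply: eq_bigr.
Qed.

(** A crude binomial tail: for [a < L], [(s - a) 'C(s, a) = (a + 1) 'C(s, a + 1)] is at most
    [L 2^s], and there are [L] such terms. *)
Lemma avgc_count_small (S : {set 'I_N}) t L : (L < #|S|)%N ->
  avgc (fun c => (count_in S t c < L)%N%:R) <= (L * L)%:R / (#|S| - L)%:R.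
Proof.
move=> ltL; rewrite (avgc_count S t (fun a => (a < L)%N%:R)).
set s := #|S| in ltL *.
have h (a : nat) : (a < L)%N -> 'C(s, a)%:R <= L%:R / (s - L)%:R * 2 ^+ s :> R.
  move=> aL; rewrite mulrAC ler_pdivlMr ?ltr0n ?subn_gt0 // -natrX -!natrM ler_nat.
  suff : ('C(s, a) * (s - a) <= L * 2 ^ s)%N.
    by apply: leq_trans; rewrite leq_mul2l; apply/orP; right; lia.
  by rewrite mulnC -mul_bin_left; apply: leq_mul; rewrite ?leq_bin2.
rewrite mulrC ler_pdivrMr ?pow2_gt0 //.
have -> : (L * L)%:R / (s - L)%:R * 2 ^+ s = \sum_(a < L) L%:R / (s - L)%:R * 2 ^+ s :> R.
  by rewrite sumr_const card_ord natrM; ring.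
have -> : \sum_(a < s.+1) 'C(s, a)%:R * (a < L)%N%:R = \sum_(a < L) 'C(s, a)%:R :> R.
  have leLs : (L <= s.+1)%N by lia.
  rewrite (big_ord_widen s.+1 (fun a => 'C(s, a)%:R) leLs) [RHS]big_mkcond /=.
  by apply: eq_bigr => a _; case: ifP; rewrite ?mulr1 ?mulr0.
by apply: ler_sum => a _; apply: h.
Qed.

End ColouringAverages.

(** * Local estimates for given arcs and a fixed colouring *)

Section LocalWeights.
Variables (N : nat).
Implicit Types (c d : {ffun 'I_N -> bool}) (x y : 'I_N).

(** Number of ways to match the inside of the arc. Scaled by [2 ^- (y - x).+1], it stands in for the
    conditional probability that the arc is present and isolated, and it depends only on the colours
    from [x] to [y]. *)
Definition arc_weight c x y : nat :=
  (c y == c x) * (catpts (class_in c true x y) * catpts (class_in c false x y)).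

Lemma class_in_bool c x y : (x < y)%N ->
  (class_in c true x y + class_in c false x y)%N = (y - x).-1.
Proof.
move=> ltxy.
have <- : #|[set z : 'I_N | (x.+1 <= z)%N && (z < y)%N]| = (y - x).-1.
  by rewrite card_ord_interval; have := ltn_ord y; lia.
rewrite /class_in -!sum1dep_card [RHS](bigID (fun z => c z == true)) /=.
congr (_ + _)%N; apply: eq_bigl => z; first by rewrite andbC.
by rewrite andbC; case: (c z).
Qed.

Lemma class_bool c : (class c true + class c false)%N = N.
Proof.
rewrite -[RHS]card_ord /class -!sum1dep_card -sum1_card.
rewrite [RHS](bigID (fun z => c z == true)) /=.
by congr (_ + _)%N; apply: eq_bigl => z; case: (c z).
Qed.

Lemma eq_class_in c d x y t :
  (forall z : 'I_N, (x < z)%N -> (z < y)%N -> c z = d z) ->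
  class_in c t x y = class_in d t x y.
Proof.
move=> cd; apply: eq_card => z; rewrite !inE.
by case: (boolP (x < z)%N) => [xz|_]; case: (boolP (z < y)%N) => [zy|_];
  rewrite ?andbF // cd.
Qed.

Lemma eq_arc_weight c d x y : (x < y)%N ->
  (forall z : 'I_N, (x <= z)%N -> (z <= y)%N -> c z = d z) ->
  arc_weight c x y = arc_weight d x y.
Proof.
move=> ltxy cd; rewrite /arc_weight !(@eq_class_in c d) ?cd //; try lia.
  by move=> z h1 h2; apply: cd; lia.
by move=> z h1 h2; apply: cd; lia.
Qed.

Lemma card_ncmatching_bool c :
  #|[set m | ncmatching c m]| = (catpts (class c true) * catpts (class c false))%N.
Proof. by rewrite card_ncmatching big_bool. Qed.

Lemma card_ncmatching_gt0 c : ~~ odd N -> evenc c -> (0 < #|[set m | ncmatching c m]|)%N.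
Proof.
move=> eN ec; rewrite card_ncmatching_bool muln_gt0 !catpts_gt0 //.
by have := class_bool c; rewrite /evenc in ec; lia.
Qed.

(** Removing the arc and its inside costs each colour at most a factor 2 per point, by
    [catpts_addn_le]; the two exponents add up to the [(y - x).+1] points from [x] to [y]. *)
Lemma arc_weight_lower c x y : (x < y)%N ->
  (arc_weight c x y * #|[set m | ncmatching c m]| <=
   2 ^ (y - x).+1 * #|[set m | ncmatching c m && iso_arc m x y]|)%N.
Proof.
move=> ltxy; rewrite card_ncmatching_bool card_iso_arc // big_bool /= /arc_weight.
case: eqP => // cyx; rewrite !mul1n.
have [oT|eT] := boolP (odd (class_in c true x y)); first by rewrite (catpts_odd oT).
have [oF|eF] := boolP (odd (class_in c false x y)); first by rewrite (catpts_odd oF) muln0.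
rewrite (_ : (y - x).+1 = (2 * (c x == true) + class_in c true x y) +
                           (2 * (c x == false) + class_in c false x y))%N; last first.
  by have := class_in_bool c ltxy; case: (c x) => /=; lia.
have ub t : ~~ odd (class_in c t x y) -> (catpts (class c t) <=
    2 ^ (2 * (c x == t) + class_in c t x y) * catpts (class_out c t x y))%N.
  move=> et; rewrite (class_split t ltxy cyx) [X in catpts X]addnC catpts_addn_le //.
  by rewrite oddD negb_add (negbTE et); case: (c x == t).
apply: leq_trans (leq_mul (leqnn _) (leq_mul (ub _ eT) (ub _ eF))) _.
by rewrite /= mulnACA (mulnCA (catpts (class_in c true x y)))
  (mulnCA (catpts (class_in c false x y))) mulnACA -expnD.
Qed.

(** The converse of [catpts_addn_le] up to the factor [1 + e], when at most [U] points are removed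
    from a class of at least [K] points. *)
Definition ratio_good (R : realFieldType) (e : R) (U K : nat) : Prop :=
  forall u v, ~~ odd u -> (u <= U)%N -> (K <= v + u)%N ->
  2 ^+ u * (catpts v)%:R <= (1 + e) * (catpts (v + u))%:R.

(** The numbers [u t] of points removed from the two classes add up to the total size of the two
    intervals; [ratio_good], used once per colour, produces the square of [1 + e]. *)
Lemma arc_weight2_upper (R : realFieldType) (e : R) U K c (x y x' y' : 'I_N) :
  0 <= e -> ratio_good e U K -> ((y - x).+1 + (y' - x').+1 <= U)%N ->
  (K <= class c true)%N -> (K <= class c false)%N ->
  (x < y)%N -> (y < x')%N -> (x' < y')%N ->
  2 ^+ ((y - x).+1 + (y' - x').+1) *
  #|[set m | [&& ncmatching c m, iso_arc m x y & iso_arc m x' y']]|%:R <=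
  (1 + e) ^+ 2 * (arc_weight c x y * arc_weight c x' y')%:R *
  #|[set m | ncmatching c m]|%:R.
Proof.
move=> e0 good dU KT KF ltxy ltyx' ltxy'.
rewrite card_ncmatching_bool card_iso_arc2 // big_bool /= /arc_weight.
case: eqP => // cyx; last by rewrite !mul0n !mulr0 mul0r.
case: eqP => // cyx'; last by rewrite !(mul0n, muln0) !mulr0 mul0r.
rewrite !mul1n.
have [oT|eT] := boolP (odd (class_in c true x y)).
  by rewrite (catpts_odd oT) !(mul0n, muln0) !mulr0 mul0r.
have [oF|eF] := boolP (odd (class_in c false x y)).
  by rewrite (catpts_odd oF) !(mul0n, muln0) !mulr0 mul0r.
have [oT'|eT'] := boolP (odd (class_in c true x' y')).
  by rewrite (catpts_odd oT') !(mul0n, muln0) !mulr0 mul0r.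
have [oF'|eF'] := boolP (odd (class_in c false x' y')).
  by rewrite (catpts_odd oF') !(mul0n, muln0) !mulr0 mul0r.
pose u t := ((2 * (c x == t) + class_in c t x y) + (2 * (c x' == t) + class_in c t x' y'))%N.
have clE t : class c t = (class_out2 c t x y x' y' + u t)%N.
  by rewrite (class_split2 t ltxy ltyx' ltxy' cyx cyx') addnC.
have uE : (u true + u false)%N = ((y - x).+1 + (y' - x').+1)%N.
  have := class_in_bool c ltxy; have := class_in_bool c ltxy'.
  by rewrite /u; case: (c x); case: (c x') => /=; lia.
have gt t : ~~ odd (class_in c t x y) -> ~~ odd (class_in c t x' y') ->
    (K <= class c t)%N ->
    2 ^+ u t * (catpts (class_out2 c t x y x' y'))%:R <= (1 + e) * (catpts (class c t))%:R.
  move=> h1 h2 h3; rewrite clE; apply: good; last by rewrite -clE.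
    by rewrite /u !oddD (negbTE h1) (negbTE h2); case: (c x == t); case: (c x' == t).
  by apply: leq_trans dU; rewrite -uE; case: (t); rewrite ?leq_addr ?leq_addl.
rewrite /= -uE exprD; have := gt _ eT eT' KT; have := gt _ eF eF' KF.
rewrite !natrM.
move: (2 ^+ u true) (2 ^+ u false) (pow2_gt0 R (u true)) (pow2_gt0 R (u false)) => p q p0 q0.
move=> hF hT; have := ler_pM _ _ hT hF.
rewrite !mulr_ge0 ?ler0n ?(ltW p0) ?(ltW q0) // => /(_ isT isT).
move=> /(ler_wpM2l (ler0n R (catpts (class_in c true x y) * catpts (class_in c false x y) *
  (catpts (class_in c true x' y') * catpts (class_in c false x' y'))))).
by rewrite !natrM; congr (_ <= _); ring.
Qed.

End LocalWeights.

(** * Probabilities of isolated arcs *)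

Lemma catalan_ratio_limit (R : archiRealFieldType) i (e : R) : 0 < e ->
  exists K, forall k, (K <= k)%N -> 4 ^+ i * (catalan k)%:R <= (1 + e) * (catalan (k + i))%:R.
Proof.
elim: i e => [|i IHi] e e0.
  by exists 0%N => k _; rewrite addn0 expr0 ler_wpM2r ?ler0n // lerDl ltW.
(* Small enough for [(1 + e')^2 <= 1 + e]: one factor pays for the step, the other for the induction
   hypothesis. *)
pose e' := Num.min e 1 / 3.
have e'0 : 0 < e' by rewrite divr_gt0 ?ltr0n // lt_min e0 ltr01.
have e'1 : (1 + e') * (1 + e') <= 1 + e.
  have : e' * 3 = Num.min e 1 by rewrite /e' divfK // pnatr_eq0.
  by case: (leP e 1) => ? ?; nra.
have [K1 h1] := IHi e' e'0.
pose K2 := Num.bound (3 / e').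
exists (maxn K1 K2) => k; rewrite geq_max => /andP[leK1 leK2].
(* By [catalan_ratio], [4 C_k / C_(k+1) = 1 + 3 / (2k + 1)], so this is exactly what a single step
   needs. *)
have k3 : 3 <= e' * (2 * k).+1%:R.
  rewrite mulrC -ler_pdivrMr //; apply: le_trans (ltW (archi_boundP _)) _.
    by rewrite divr_ge0 ?ler0n // ltW.
  by rewrite ler_nat -/K2; lia.
have step : 4 * (catalan k)%:R <= (1 + e') * (catalan k.+1)%:R.
  have := congr1 (fun n => n%:R : R) (catalan_ratio k); rewrite !natrM.
  have : 0 <= (catalan k.+1)%:R :> R by rewrite ler0n.
  have -> : k.+2%:R = k%:R + 2 :> R by rewrite -addn2 natrD.
  have := k3; rewrite (_ : (2 * k).+1%:R = 2 * k%:R + 1 :> R); last first.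
    by rewrite -addn1 natrD natrM.
  have := ler0n R k; move: (catalan k)%:R (catalan k.+1)%:R k%:R => a b t.
  move=> t0 k3' b0 ab.
  rewrite -(ler_pM2r (_ : 0 < 2 * t + 1)); last lra.
  nra.
rewrite exprS -mulrA mulrCA; apply: le_trans (ler_wpM2l _ step) _.
  by rewrite exprn_ge0 // ler0n.
rewrite mulrCA; apply: le_trans (ler_wpM2l _ (h1 k.+1 _)) _.
- by rewrite addr_ge0 // ltW.
- by lia.
by rewrite mulrA addSnnS ler_wpM2r ?ler0n.
Qed.

Lemma ratio_good_exists (R : archiRealFieldType) (e : R) U :
  0 < e -> exists K, ratio_good e U K.
Proof.
move=> e0.
have [K hK] : exists K, forall i, (i <= U)%N -> forall k, (K <= k)%N ->
    4 ^+ i * (catalan k)%:R <= (1 + e) * (catalan (k + i))%:R.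
  elim: U => [|U [K hK]].
    have [K hK] := catalan_ratio_limit 0 e0.
    by exists K => i; rewrite leqn0 => /eqP ->.
  have [K' hK'] := catalan_ratio_limit U.+1 e0.
  exists (maxn K K') => i leiU k; rewrite geq_max => /andP[lek lek'].
  have [ltiU|] := ltnP i U.+1; first exact: hK.
  by move=> leUi; rewrite (_ : i = U.+1) ?hK' //; lia.
exists (2 * K + U)%N => u v eu leU leK.
have [ov|ev] := boolP (odd v).
  by rewrite (catpts_odd ov) mulr0 mulr_ge0 ?ler0n // addr_ge0 // ltW.
have [-> ->] := catpts_half ev eu.
have -> : 2 ^+ u = 4 ^+ u./2 :> R.
  have -> : 4 = 2 ^+ 2 :> R by rewrite -natrX.
  by rewrite -exprM; congr (_ ^+ _); lia.
by apply: hK; lia.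
Qed.

(** Limiting probability that two points at distance [d] form an isolated arc: the factor [2^-1] is
    for equal colours at the ends, and the sum averages over the number [a] of red points among the
    [d.-1] inside. *)
Definition qarc (R : realFieldType) d : R :=
  2 ^- d.+1 * (2^-1 * (2 ^- d.-1 *
  \sum_(a < d.-1.+1) 'C(d.-1, a)%:R * (catpts a * catpts (d.-1 - a))%:R)).

Section ArcAverages.
Variables (R : realFieldType) (N : nat).
Implicit Types (c d : {ffun 'I_N -> bool}) (x y z : 'I_N).

Lemma avgc_arc_weight x y : (x < y)%N ->
  2 ^- (y - x).+1 * avgc (fun c => (arc_weight c x y)%:R) = qarc R (y - x).
Proof.
move=> ltxy; congr (_ * _); set S := [set z : 'I_N | (x.+1 <= z)%N && (z < y)%N].
have cardS : #|S| = (y - x).-1.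
  by rewrite card_ord_interval; have := ltn_ord y; lia.
pose phi a : R := (catpts a * catpts (#|S| - a))%:R.
have inT c : class_in c true x y = count_in S true c.
  by apply: eq_card => z; rewrite !inE andbC.
have inF c : class_in c false x y = (#|S| - count_in S true c)%N.
  by rewrite -inT cardS -(class_in_bool c ltxy) addKn.
have Sf c : count_in S true (flip x c) = count_in S true c.
  apply: eq_card => z; rewrite !inE; case: (boolP (x < z)%N) => //= xz.
  by rewrite flip_neq // -(inj_eq val_inj) /= gtn_eqF.
rewrite -cardS -(avgc_count S true phi).
(* Of [c] and [flip x c] exactly one gives [x] and [y] equal colours, and the inside is
   unchanged. *)
set X := avgc _; have -> : X = 2^-1 * (X + X) by field.
congr (_ * _); rewrite /X -{2}(avgc_flip x) -avgcD; apply: eq_avgc => c.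
rewrite /arc_weight !inT !inF Sf flip_eq flip_neq; last first.
  by rewrite -(inj_eq val_inj) /= gtn_eqF.
by rewrite -natrD -mulnDl /phi; case: (c x); case: (c y); rewrite mul1n.
Qed.

(** The point [z] off the arc absorbs the parity condition through [avge_free]. *)
Lemma avge_arc_weight x y z : (x < y)%N -> (z < x)%N || (y < z)%N ->
  2 ^- (y - x).+1 * avge (fun c => (arc_weight c x y)%:R) = qarc R (y - x).
Proof.
move=> ltxy zout; rewrite (@avge_free _ _ z) ?avgc_arc_weight // => c.
congr (_%:R); apply: eq_arc_weight => // w xw wy; rewrite flip_neq //.
by rewrite -(inj_eq val_inj) /=; lia.
Qed.

(** Besides the free point [z], this uses that the two weights depend on disjoint sets of points,
    separated by [y]. *)
Lemma avge_arc_weight2 x y x' y' z : (x < y)%N -> (y < x')%N -> (x' < y')%N ->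
  (z < x)%N || (y < z)%N -> (z < x')%N || (y' < z)%N ->
  2 ^- ((y - x).+1 + (y' - x').+1) *
  avge (fun c => (arc_weight c x y * arc_weight c x' y')%:R) =
  qarc R (y - x) * qarc R (y' - x').
Proof.
move=> ltxy ltyx' ltxy' zout zout'; rewrite (@avge_free _ _ z); last first.
  move=> c; congr ((_ * _)%:R); apply: eq_arc_weight => // w xw wy; rewrite flip_neq //;
  by rewrite -(inj_eq val_inj) /=; lia.
under eq_avgc do rewrite natrM.
rewrite (@avgc_indep _ _ (fun w : 'I_N => w <= y)%N).
- by rewrite exprD invfM mulrACA !avgc_arc_weight.
- by move=> c d cd; congr (_%:R); apply: eq_arc_weight => // w xw wy; apply: cd.
- move=> c d cd; congr (_%:R); apply: eq_arc_weight => // w xw wy; apply: cd.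
  by change (~~ (w <= y)%N); lia.
Qed.
End ArcAverages.

(** * Expectation over colourings and matchings *)

Section Expectation.
Variables (R : realFieldType) (N : nat).
Implicit Types (c : {ffun 'I_N -> bool}) (f : {ffun 'I_N -> 'I_N} -> R)
  (A : pred {ffun 'I_N -> 'I_N}).

Definition expm c f : R :=
  (\sum_(m | ncmatching c m) f m) / #|[set m | ncmatching c m]|%:R.

Definition expect f : R := avge (fun c => expm c f).

Lemma expm_ind c A : expm c (fun m => (A m)%:R) =
  #|[set m | ncmatching c m && A m]|%:R / #|[set m | ncmatching c m]|%:R.
Proof.
congr (_ / _); rewrite -sum1dep_card natr_sum [RHS]big_mkcondr /=.
by apply: eq_bigr => m _; case: (A m).
Qed.

Lemma eq_expect f g : f =1 g -> expect f = expect g.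
Proof.
by move=> fg; congr (_ * _); apply: eq_bigr => c _; congr (_ / _); apply: eq_bigr.
Qed.

Lemma expmD c f g : expm c (fun m => f m + g m) = expm c f + expm c g.
Proof. by rewrite /expm big_split mulrDl. Qed.

Lemma expmZ c a f : expm c (fun m => a * f m) = a * expm c f.
Proof. by rewrite /expm -mulr_sumr mulrA. Qed.

Lemma expectD f g : expect (fun m => f m + g m) = expect f + expect g.
Proof. by rewrite /expect -avgeD; congr (_ * _); apply: eq_bigr => c _; rewrite expmD. Qed.

Lemma expectZ a f : expect (fun m => a * f m) = a * expect f.
Proof. by rewrite /expect -avgeZ; congr (_ * _); apply: eq_bigr => c _; rewrite expmZ. Qed.

Lemma expm_sum (I : finType) (P : pred I) (F : I -> {ffun 'I_N -> 'I_N} -> R) c :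
  expm c (fun m => \sum_(i | P i) F i m) = \sum_(i | P i) expm c (F i).
Proof. by rewrite /expm exchange_big /= mulr_suml. Qed.

Lemma expect_sum (I : finType) (P : pred I) (F : I -> {ffun 'I_N -> 'I_N} -> R) :
  expect (fun m => \sum_(i | P i) F i m) = \sum_(i | P i) expect (F i).
Proof.
rewrite /expect /avge -mulr_sumr exchange_big /=; congr (_ * _).
by apply: eq_bigr => c _; rewrite expm_sum.
Qed.

Lemma ler_expm c f g : (forall m, ncmatching c m -> f m <= g m) -> expm c f <= expm c g.
Proof. by move=> le; rewrite ler_wpM2r ?invr_ge0 ?ler0n // ler_sum. Qed.

Lemma ler_expect f g :
  (forall c m, evenc c -> ncmatching c m -> f m <= g m) -> expect f <= expect g.
Proof. by move=> le; apply: ler_avge => c ec; apply: ler_expm => m; apply: le ec. Qed.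

Lemma expect_ge0 f : (forall m, 0 <= f m) -> 0 <= expect f.
Proof.
move=> f0; rewrite mulr_ge0 ?invr_ge0 ?exprn_ge0 ?ler0n // sumr_ge0 // => c _.
by rewrite divr_ge0 ?ler0n // sumr_ge0.
Qed.

Hypothesis evenN : ~~ odd N.

Lemma expm1 c : evenc c -> expm c (fun=> 1) = 1.
Proof.
move=> ec; rewrite /expm sumr_const; set k := #|_|; set l := #|_|.
have -> : k = l by apply: eq_card => m; rewrite !inE.
by rewrite divff // pnatr_eq0 -lt0n card_ncmatching_gt0.
Qed.

Lemma expect1 : (0 < N)%N -> expect (fun=> 1) = 1.
Proof.
move=> N0; rewrite -[RHS](avge1 R N0); congr (_ * _).
by apply: eq_bigr => c ec; rewrite expm1.
Qed.

Lemma expect_iso_lower (x y z : 'I_N) : (x < y)%N -> (z < x)%N || (y < z)%N ->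
  qarc R (y - x) <= expect (fun m => (iso_arc m x y)%:R).
Proof.
move=> ltxy zout; rewrite -(avge_arc_weight _ ltxy zout) -avgeZ.
apply: ler_avge => c ec; rewrite expm_ind ler_pdivlMr; last first.
  by rewrite ltr0n card_ncmatching_gt0.
rewrite -mulrA ler_pdivrMl ?pow2_gt0 // -natrX -!natrM ler_nat.
exact: arc_weight_lower.
Qed.

(** Where both classes have at least [K] points, [arc_weight2_upper] applies; elsewhere the
    conditional probability is bounded by 1. The 4 counts two colours times the factor 2 of
    [avge_le_avgc]. *)
Lemma expect_iso2_upper (e : R) U K (x y x' y' z : 'I_N) :
  0 <= e -> ratio_good e U K -> ((y - x).+1 + (y' - x').+1 <= U)%N ->
  (x < y)%N -> (y < x')%N -> (x' < y')%N ->
  (z < x)%N || (y < z)%N -> (z < x')%N || (y' < z)%N -> (K < N)%N ->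
  expect (fun m => (iso_arc m x y && iso_arc m x' y')%:R) <=
  (1 + e) ^+ 2 * (qarc R (y - x) * qarc R (y' - x')) +
  4 * ((K * K)%:R / (N - K)%:R).
Proof.
move=> e0 good dU ltxy ltyx' ltxy' zout zout' KN.
rewrite -(avge_arc_weight2 R ltxy ltyx' ltxy' zout zout') [(1 + e) ^+ 2 * _]mulrA -avgeZ.
pose rare t c : R := (count_in [set: 'I_N] t c < K)%N%:R.
have rareE t c : rare t c = (class c t < K)%N%:R.
  by congr ((_ < _)%N%:R); apply: eq_card => w; rewrite !inE.
have rare_le t : avgc (rare t) <= (K * K)%:R / (N - K)%:R.
  have := @avgc_count_small R N [set: 'I_N] t K; rewrite cardsT card_ord; exact.
have rare0 t c : 0 <= rare t c by rewrite ler0n.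
suff : expect (fun m => (iso_arc m x y && iso_arc m x' y')%:R) <=
   avge (fun c => (1 + e) ^+ 2 * 2 ^- ((y - x).+1 + (y' - x').+1) *
        (arc_weight c x y * arc_weight c x' y')%:R + (rare true c + rare false c)).
  move=> h; apply: le_trans h _; rewrite !avgeD lerD2l.
  have := avge_le_avgc (rare0 true); have := avge_le_avgc (rare0 false).
  by have := rare_le true; have := rare_le false; lra.
apply: ler_avge => c ec; rewrite expm_ind.
have c0 : 0 < #|[set m | ncmatching c m]|%:R :> R by rewrite ltr0n card_ncmatching_gt0.
have w0 : 0 <= (1 + e) ^+ 2 * 2 ^- ((y - x).+1 + (y' - x').+1) *
        (arc_weight c x y * arc_weight c x' y')%:R.
  have e1 : 0 <= 1 + e by lra.
  by rewrite !mulr_ge0 ?invr_ge0 ?exprn_ge0 ?ler0n.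
have p1 : #|[set m | ncmatching c m && (iso_arc m x y && iso_arc m x' y')]|%:R /
    #|[set m | ncmatching c m]|%:R <= 1 :> R.
  rewrite ler_pdivrMr // mul1r ler_nat; apply: subset_leq_card.
  by apply/subsetP => m; rewrite !inE => /andP[].
rewrite !rareE; have [KT|] := leqP K (class c true); last first.
  move=> _ /=; apply: (le_trans p1).
  have : 0 <= (class c false < K)%N%:R :> R by rewrite ler0n.
  by rewrite -[true%:R]/1; lra.
have [KF|] := leqP K (class c false); last first.
  by move=> _ /=; apply: (le_trans p1); rewrite -[true%:R]/1 -[false%:R]/0; lra.
rewrite !addr0 ler_pdivrMr // -[_ * 2 ^- _]mulrC -2!mulrA ler_pdivlMl ?pow2_gt0 //.
by rewrite mulrA; apply: arc_weight2_upper good _ _ _ _ _ _.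
Qed.
End Expectation.

(** * Long arcs *)

Section CentralBinomial.
Variable R : realFieldType.

Definition cbin l : R := 'C(2 * l, l)%:R / 4 ^+ l.

Lemma pow4_neq0 k : 4 ^+ k != 0 :> R.
Proof. by rewrite expf_neq0 // pnatr_eq0. Qed.

Lemma cbin_ge0 l : 0 <= cbin l.
Proof. by rewrite divr_ge0 ?exprn_ge0 ?ler0n. Qed.

Lemma cbinS l : (2 * l + 2)%:R * cbin l.+1 = (2 * l + 1)%:R * cbin l.
Proof.
have := congr1 (fun n => n%:R : R) (bin_centralS l); rewrite !natrM => h.
rewrite /cbin exprS invfM.
have -> : (2 * l + 2)%:R = 2 * l.+1%:R :> R by rewrite -natrM; congr _%:R; lia.
have -> : (2 * l + 1)%:R = (2 * l).+1%:R :> R by rewrite addn1.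
have -> : 2 * l.+1%:R * ('C(2 * l.+1, l.+1)%:R * (4^-1 * 4 ^- l)) =
  2 * 4^-1 * 4 ^- l * (l.+1%:R * 'C(2 * l.+1, l.+1)%:R) :> R by ring.
by rewrite h; field; rewrite pow4_neq0.
Qed.

(** Telescoping: [cbinS] gives [C_l / 4^l = 2 (cbin l - cbin (l + 1))]. *)
Lemma sum_catalan_cbin l :
  \sum_(0 <= i < l) (catalan i)%:R / 4 ^+ i = 2 * (1 - cbin l) :> R.
Proof.
elim: l => [|l IHl]; first by rewrite big_geq // /cbin bin0 expr0 divr1 subrr mulr0.
rewrite big_nat_recr //= IHl.
have := cbinS l; have := congr1 (fun n => n%:R : R) (catalanE l).
rewrite natrM => h1.
have -> : cbin l = l.+1%:R * ((catalan l)%:R / 4 ^+ l) by rewrite mulrA h1.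
have -> : (2 * l + 2)%:R = 2 * l.+1%:R :> R by rewrite -natrM; congr _%:R; lia.
have -> : (2 * l + 1)%:R = 2 * l.+1%:R - 1 :> R.
  by apply: (addIr 1); rewrite subrK -natrM natr1; congr _%:R; lia.
set t := _ / _; set b := cbin _; have : l.+1%:R != 0 :> R by rewrite pnatr_eq0.
move: (l.+1%:R) => k k0 h2; apply: (mulfI k0); lra.
Qed.

(** Gives decay of order [l^(-1/2)] without Stirling's formula; the induction rests on
    [(2l + 1)(2l + 3) <= (2l + 2)^2]. *)
Lemma cbin_sq l : (2 * l + 1)%:R * cbin l ^+ 2 <= 1.
Proof.
elim: l => [|l IHl]; first by rewrite /cbin bin0 expr0 divr1 expr1n mulr1.
have e1 k : (2 * l + k)%:R = 2 * l%:R + k%:R :> R by rewrite natrD natrM.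
have := cbinS l; have := IHl; rewrite !e1.
have -> : (2 * l.+1 + 1)%:R = 2 * (l%:R + 1) + 1 :> R by rewrite natrD natrM natr1.
have : 0 <= l%:R :> R by rewrite ler0n.
have := cbin_ge0 l; have := cbin_ge0 l.+1.
move: l%:R (cbin l) (cbin l.+1) => t a b b0 a0 t0 h1 h2.
have u0 : 0 < 2 * t + 2 by lra.
rewrite -(ler_pM2r (mulr_gt0 u0 u0)) mul1r.
have -> : (2 * (t + 1) + 1) * b ^+ 2 * ((2 * t + 2) * (2 * t + 2)) =
  (2 * t + 3) * ((2 * t + 2) * b) ^+ 2 by ring.
rewrite h2.
have -> : (2 * t + 3) * ((2 * t + 1) * a) ^+ 2 =
  ((2 * t + 3) * (2 * t + 1)) * ((2 * t + 1) * a ^+ 2) by ring.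
have : (2 * t + 3) * (2 * t + 1) * ((2 * t + 1) * a ^+ 2) <= (2 * t + 3) * (2 * t + 1) * 1.
  by apply: ler_wpM2l => //; nra.
move=> /le_trans; apply; nra.
Qed.
End CentralBinomial.

Lemma cbin_small (R : archiRealFieldType) (e : R) : 0 < e -> exists l, cbin R l <= e.
Proof.
move=> e0; exists (Num.bound (e ^- 2)); set l := Num.bound _.
have h : e ^- 2 < l%:R by apply: archi_boundP; rewrite invr_ge0 exprn_ge0 // ltW.
have h2 := cbin_sq R l; rewrite natrD natrM in h2.
have h3 : 1 < l%:R * e ^+ 2 by rewrite -ltr_pdivrMr ?exprn_gt0 // mul1r.
have h4 := cbin_ge0 R l.
rewrite -(@ler_pXn2r _ 2) ?nnegrE ?(ltW e0) //.
have l0 : 0 < l%:R :> R by apply: le_lt_trans h; rewrite invr_ge0 exprn_ge0 // ltW.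
move: h2 h3; move: (cbin R l ^+ 2) (e ^+ 2) (sqr_ge0 (cbin R l)) => a b a0 h2 h3.
rewrite -(ler_pM2l l0); lra.
Qed.

(** * Mass of the middle range in the Catalan recurrence *)

Section MiddleSum.
Variables (R : realFieldType) (s l : nat).
Hypothesis evens : ~~ odd s.
Let g i : R := (catpts i * catpts (s - 2 - i))%:R.

(** [catpts_addn_le] bounds the [i]-th term below by [catpts i / 2^(i+2)] times [catpts s]. The
    terms with [i = 2j] are [C_j 4^-j / 4], summed by [sum_catalan_cbin]. *)
Lemma sum_even_ends : (2 * l < s)%N ->
  (1 - cbin R l) / 2 * (catpts s)%:R <= \sum_(0 <= i < 2 * l) g i.
Proof.
move=> ls.
have -> : (1 - cbin R l) / 2 = \sum_(0 <= i < 2 * l) (catpts i)%:R / 2 ^+ i.+2.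
  have := sum_catalan_cbin R l; have -> : (1 - cbin R l) / 2 = 4^-1 * (2 * (1 - cbin R l)) by field.
  move=> <-; elim: (l) => [|k IHk]; first by rewrite !big_geq // mulr0.
  rewrite (_ : (2 * k.+1 = (2 * k).+2)%N) ?big_nat_recr //=; last by lia.
  rewrite mulrDr IHk -addrA; congr (_ + _).
  rewrite (@catpts_odd (2 * k).+1) ?mul0r ?addr0 ?catpts_double; last by lia.
  rewrite mulrCA -invfM; congr (_ * _^-1).
  by rewrite !exprS exprM (_ : 2 ^+ 2 = 4) ?mulrA -?natrX // -natrM.
rewrite mulr_suml big_nat_cond [X in _ <= X]big_nat_cond; apply: ler_sum => i /andP[/andP[_ il] _].
have [oi|ei] := boolP (odd i); first by rewrite /g (catpts_odd oi) !mul0r.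
rewrite mulrAC ler_pdivrMr ?pow2_gt0 // /g -natrX -!natrM ler_nat -mulnA leq_mul2l.
apply/orP; right; have -> : (s = s - 2 - i + i.+2)%N by lia.
rewrite mulnC (_ : (s - 2 - i + i.+2 - 2 - i = s - 2 - i)%N); last by lia.
by apply: catpts_addn_le; rewrite /= negbK.
Qed.

(** The whole sum is [catpts s], and by symmetry each end takes at least the share
    [(1 - cbin R l) / 2]. If the ends overlap, the middle is empty. *)
Lemma sum_middle :
  \sum_(2 * l <= i < s - 1 - 2 * l) g i <= cbin R l * (catpts s)%:R.
Proof.
have [small|big] := leqP (s - 1 - 2 * l) (2 * l).
  by rewrite big_geq // mulr_ge0 ?ler0n ?cbin_ge0.
have s0 : (0 < s)%N by lia.
have total : \sum_(0 <= i < s - 1) g i = (catpts s)%:R.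
  by rewrite -(catpts_convolution s0) natr_sum big_mkord subn1.
have l1 : (2 * l <= s - 1 - 2 * l)%N by lia.
rewrite (@big_cat_nat _ _ _ (2 * l)) //= in total; last by lia.
rewrite (@big_cat_nat _ _ _ (s - 1 - 2 * l) (2 * l)) //= in total; last by lia.
have ends : \sum_(s - 1 - 2 * l <= i < s - 1) g i = \sum_(0 <= i < 2 * l) g i.
  rewrite big_nat_rev -{1}[(s - 1 - 2 * l)%N]add0n big_addn.
  rewrite (_ : (s - 1 - (s - 1 - 2 * l) = 2 * l)%N); last by lia.
  rewrite big_nat_cond [RHS]big_nat_cond; apply: eq_bigr => i /andP[/andP[_ il] _].
  by rewrite /g mulnC; congr ((catpts _ * catpts _)%:R); lia.
have := sum_even_ends; rewrite ends in total.
have ls : (2 * l < s)%N by lia.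
move=> /(_ ls); lra.
Qed.
End MiddleSum.

(** * Probability of long arcs *)

Section Tail.
Variables (R : realFieldType) (N : nat).
Hypothesis evenN : ~~ odd N.
Implicit Types (c : {ffun 'I_N -> bool}) (x y z : 'I_N).

Lemma evenc_class c t : evenc c -> ~~ odd (class c t).
Proof. by move=> ec; have := class_bool c; rewrite /evenc in ec; case: t => //; lia. Qed.

Lemma expm_arc c x y : evenc c -> (x < y)%N ->
  expm c (fun m => (m x == y)%:R) =
  (c y == c x)%:R * ((catpts (class_in c (c x) x y) * catpts (class_out c (c x) x y))%:R /
    (catpts (class c (c x)))%:R) :> R.
Proof.
move=> ec ltxy; rewrite (expm_ind R c (fun m => m x == y)) card_arc_matching //.
rewrite card_ncmatching [X in _ / X%:R](bigD1 (c x)) //= !natrM.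
have c0 : (catpts (class c (c x)))%:R != 0 :> R.
  by rewrite pnatr_eq0 -lt0n catpts_gt0 // evenc_class.
have p0 : (\prod_(t | t != c x) catpts (class c t))%:R != 0 :> R.
  by rewrite pnatr_eq0 -lt0n prodn_cond_gt0 // => t _; rewrite catpts_gt0 // evenc_class.
by field; rewrite c0 p0.
Qed.

Lemma expm_arc_le1 c x (P : pred 'I_N) : evenc c ->
  \sum_(y | P y) expm c (fun m => (m x == y)%:R) <= 1 :> R.
Proof.
move=> ec; rewrite -expm_sum -[X in _ <= X](expm1 R evenN ec).
apply: ler_expm => m _; rewrite (bigID (pred1 (m x))) /= [X in _ + X]big1 ?addr0.
  rewrite big_mkcondl big_pred1_eq eqxx; by case: (P _).
by move=> y /andP[_ /negbTE]; rewrite eq_sym => ->.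
Qed.

(** If [x] has at least [2 * l] points of its colour before it and as many in the window after it,
    then an arc of length at least [W] has at least [2 * l] such points both inside and outside, so
    [sum_middle] applies. Otherwise the bound 1 is charged to an indicator. *)
Lemma tail_arc_colouring c x W l : evenc c -> (0 < W)%N ->
  \sum_(y : 'I_N | (x + W <= y)%N) expm c (fun m => (m x == y)%:R) <=
  cbin R l +
  (count_in [set z : 'I_N | (x.+1 <= z)%N && (z < x + W)%N] (c x) c < 2 * l)%N%:R +
  (count_in [set z : 'I_N | (0 <= z)%N && (z < x)%N] (c x) c < 2 * l)%N%:R.
Proof.
move=> ec W0; set S1 := finset _; set S2 := finset _.
have D0 := cbin_ge0 R l.
have [near1|far1] := ltnP (count_in S1 (c x) c) (2 * l).
  apply: (le_trans (expm_arc_le1 _ _ ec)); rewrite -[true%:R]/1.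
  have : 0 <= (count_in S2 (c x) c < 2 * l)%N%:R :> R by rewrite ler0n.
  lra.
have [near2|far2] := ltnP (count_in S2 (c x) c) (2 * l).
  by apply: (le_trans (expm_arc_le1 _ _ ec)); rewrite -[true%:R]/1 -[false%:R]/0; lra.
rewrite !addr0; set s := class c (c x).
have es : ~~ odd s by apply: evenc_class.
have s0 : 0 < (catpts s)%:R :> R by rewrite ltr0n catpts_gt0.
pose P := [set y : 'I_N | (x < y)%N && (c y == c x)].
(* Zero off the middle range, so that the sum may run over all ranks before it is cut back. *)
pose F i : R := if (2 * l <= i)%N && (2 * l <= s - 2 - i)%N
  then (catpts i * catpts (s - 2 - i))%:R / (catpts s)%:R else 0.
have F0 i : 0 <= F i by rewrite /F; case: ifP => // _; rewrite divr_ge0 ?ler0n.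
have rank y : y \in P -> class_in c (c x) x y = #|[set z in P | (z < y)%N]|.
  move=> _; apply: eq_card => z; rewrite !inE; case: (c z == c x); rewrite ?andbT ?andbF //.
have cardP : (#|P| <= s - 1)%N.
  have := cardsD1 x [set z | c z == c x]; rewrite inE eqxx -/(class c (c x)) -/s.
  suff : (#|P| <= #|[set z | c z == c x] :\ x|)%N by lia.
  apply: subset_leq_card.
  apply/subsetP => y; rewrite !inE => /andP[xy ->]; rewrite andbT.
  by rewrite -(inj_eq val_inj) /= gtn_eqF.
apply: (@le_trans _ _ (\sum_(y in P) F #|[set z in P | (z < y)%N]|)).
  rewrite big_mkcond [X in _ <= X]big_mkcond; apply: ler_sum => y _.
  case: (boolP (x + W <= y)%N) => [leW|_]; last by case: ifP.
  have ltxy : (x < y)%N by lia.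
  rewrite expm_arc // inE ltxy /=; case: eqP => [cyx|_]; last by rewrite mul0r.
  have yP : y \in P by rewrite inE ltxy cyx eqxx.
  rewrite mul1r -(rank y yP).
  have outE := class_out_subn ltxy (erefl (c x)) cyx.
  have in_ge : (2 * l <= class_in c (c x) x y)%N.
    apply: leq_trans far1 _; apply: subset_leq_card; apply/subsetP => z.
    by rewrite !inE => /andP[/andP[h1 h2] ->]; lia.
  have out_ge : (2 * l <= class_out c (c x) x y)%N.
    apply: leq_trans far2 _; apply: subset_leq_card; apply/subsetP => z.
    by rewrite !inE => /andP[/andP[h1 h2] ->]; rewrite h2.
  by rewrite /F -/s in outE *; rewrite -outE in_ge out_ge.
rewrite (big_rank _ P F) -(big_mkord predT F).
apply: (@le_trans _ _ (\sum_(0 <= i < s - 1) F i)).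
  by rewrite [X in _ <= X](@big_cat_nat _ _ _ #|P|) //= lerDl sumr_ge0.
apply: (@le_trans _ _ (\sum_(2 * l <= i < s - 1 - 2 * l)
    (catpts i * catpts (s - 2 - i))%:R / (catpts s)%:R)); last first.
  by rewrite -mulr_suml ler_pdivrMr // sum_middle.
rewrite (big_nat_widenl (2 * l) 0) // (big_nat_widen 0 _ (s - 1)) //; last by lia.
rewrite [X in _ <= X]big_mkcond; apply: ler_sum_nat => i /andP[_ lti] /=; rewrite /F.
case: (boolP (2 * l <= i)%N) => //= h1; rewrite (_ : (i < s - 1 - 2 * l)%N = (2 * l <= s - 2 - i)%N) //.
by lia.
Qed.

(** The 8 counts two colours, two windows and the factor 2 of [avge_le_avgc]; [W <= x] makes the
    window before [x] large enough. *)
Lemma expect_tail_arc x W l : (2 * l < W.-1)%N -> (W <= x)%N ->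
  \sum_(y : 'I_N | (x + W <= y)%N) expect (fun m => (m x == y)%:R) <=
  cbin R l + 8 * ((2 * l * (2 * l))%:R / (W.-1 - 2 * l)%:R).
Proof.
move=> lW Wx; set B := _ / _; have B0 : 0 <= B by rewrite divr_ge0 ?ler0n.
have D0 := cbin_ge0 R l.
have [leN|ltN] := leqP N (x + W).
  rewrite big_pred0 => [|y]; first lra.
  by apply/negbTE; have := ltn_ord y; lia.
set S1 := [set z : 'I_N | (x.+1 <= z)%N && (z < x + W)%N].
set S2 := [set z : 'I_N | (0 <= z)%N && (z < x)%N].
have card1 : #|S1| = W.-1 by rewrite card_ord_interval; lia.
have card2 : #|S2| = x by rewrite card_ord_interval; have := ltn_ord x; lia.
pose rare S t c : R := (count_in S t c < 2 * l)%N%:R.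
have rare0 S t c : 0 <= rare S t c by rewrite ler0n.
have r1 t : avgc (rare S1 t) <= B.
  by have := @avgc_count_small R N S1 t (2 * l); rewrite card1; exact.
have r2 t : avgc (rare S2 t) <= B.
  have := @avgc_count_small R N S2 t (2 * l); rewrite card2 => h.
  apply: le_trans (h _) _; first by lia.
  rewrite ler_wpM2l ?ler0n // lef_pV2 ?posrE ?ltr0n ?subn_gt0 ?ler_nat //; lia.
apply: (@le_trans _ _ (avge (fun c => cbin R l * 1 +
   ((rare S1 true c + rare S1 false c) + (rare S2 true c + rare S2 false c))))).
  rewrite /expect /avge -mulr_sumr exchange_big /=; apply: ler_avge => c ec.
  apply: le_trans (tail_arc_colouring x l ec (_ : 0 < W)%N) _; first by lia.
  rewrite -/S1 -/S2 -/(rare S1 (c x) c) -/(rare S2 (c x) c) mulr1 -addrA lerD2l.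
  have := rare0 S1 true c; have := rare0 S1 false c.
  have := rare0 S2 true c; have := rare0 S2 false c.
  by case: (c x); lra.
have N0 : (0 < N)%N by have := ltn_ord x; lia.
rewrite !avgeD avgeZ avge1 // mulr1 lerD2l.
have := r1 true; have := r1 false; have := r2 true; have := r2 false.
have := avge_le_avgc (rare0 S1 true); have := avge_le_avgc (rare0 S1 false).
have := avge_le_avgc (rare0 S2 true); have := avge_le_avgc (rare0 S2 false).
by lra.
Qed.

(** The first [W] points lack room on their left; each starts at most one arc, which accounts for
    the term [W%:R]. *)
Lemma expect_tail W l : (2 * l < W.-1)%N ->
  expect (fun m => \sum_(x : 'I_N) \sum_(y : 'I_N | (x + W <= y)%N) (iso_arc m x y)%:R) <=
  W%:R + N%:R * (cbin R l + 8 * ((2 * l * (2 * l))%:R / (W.-1 - 2 * l)%:R)).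
Proof.
move=> lW; set E := cbin R l + _.
have E0 : 0 <= E by apply: addr_ge0; [exact: cbin_ge0 | rewrite mulr_ge0 ?divr_ge0 ?ler0n].
rewrite expect_sum.
apply: (@le_trans _ _ (\sum_(x : 'I_N) ((x < W)%N%:R + E))).
  apply: ler_sum => x _.
  apply: (@le_trans _ _ (expect (fun m => \sum_(y : 'I_N | (x + W <= y)%N) (m x == y)%:R))).
    apply: ler_expect => c m _ _; apply: ler_sum => y _.
    by rewrite ler_nat /iso_arc; case: (m x == y); rewrite //= leq_b1.
  have [xW|Wx] := ltnP x W; last by rewrite add0r expect_sum; apply: expect_tail_arc.
  have N0 : (0 < N)%N by have := ltn_ord x; lia.
  apply: (@le_trans _ _ 1); last by rewrite -[true%:R]/1; lra.
  rewrite -[X in _ <= X](expect1 R evenN N0); apply: ler_avge => c ec.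
  by rewrite (expm1 R evenN ec) expm_sum; apply: expm_arc_le1.
rewrite big_split /= sumr_const card_ord -[_ *+ N]mulr_natl lerD2r.
rewrite -natr_sum ler_nat.
have -> : (\sum_(x < N) (x < W) = #|[set z : 'I_N | (0 <= z) && (z < W)]|)%N.
  by rewrite -sum1dep_card [RHS]big_mkcond; apply: eq_bigr => z _; rewrite leq0n; case: ltnP.
by rewrite card_ord_interval subn0 geq_minl.
Qed.
End Tail.

(** * Short arcs *)

(** Limiting number per point of isolated arcs shorter than [W]; twice this is a partial sum of the
    series for gamma. *)
Definition gpart (R : realFieldType) W : R := \sum_(1 <= d < W) qarc R d.

Lemma qarc_ge0 (R : realFieldType) d : 0 <= qarc R d.
Proof.
by rewrite !mulr_ge0 ?invr_ge0 ?exprn_ge0 ?ler0n ?sumr_ge0 // => i _; rewrite mulr_ge0 ?ler0n.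
Qed.

Lemma gpart_ge0 (R : realFieldType) W : 0 <= gpart R W.
Proof. by rewrite sumr_ge0 // => d _; apply: qarc_ge0. Qed.

Section ShortArcs.
Variables (R : realFieldType) (N W : nat).
Hypothesis evenN : ~~ odd N.
Hypothesis W_gt0 : (0 < W)%N.
Implicit Types (m : {ffun 'I_N -> 'I_N}) (x y z : 'I_N).

Definition short x y := (x < y)%N && (y < x + W)%N.

Definition short_iso m : R := \sum_x \sum_(y | short x y) (iso_arc m x y)%:R.

Lemma sum_iso_le1 m x (P : pred 'I_N) : \sum_(y | P y) (iso_arc m x y)%:R <= 1 :> R.
Proof.
rewrite (bigID (pred1 (m x))) /= [X in _ + X]big1 ?addr0.
  by rewrite big_mkcondl big_pred1_eq; case: (P _) => //; rewrite lern1 leq_b1.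
by move=> y /andP[_ /negbTE]; rewrite eq_sym /iso_arc => ->.
Qed.

Lemma short_iso_le m : short_iso m <= N%:R.
Proof.
rewrite -[X in X%:R]card_ord -sumr_const; apply: ler_sum => x _.
exact: sum_iso_le1.
Qed.

Lemma sum_short x (F : nat -> R) :
  \sum_(y | short x y) F y = \sum_(x.+1 <= y < minn (x + W) N) F y.
Proof. exact: (big_ord_interval _ N x.+1 (x + W) F). Qed.

Lemma sum_short_eq x (F : nat -> R) :
  \sum_(y | short x y) F (y - x)%N = \sum_(1 <= d < minn W (N - x)) F d.
Proof.
rewrite (sum_short x (fun k => F (k - x)%N)) -(add1n x) big_addn.
rewrite (_ : (minn (x + W) N - x = minn W (N - x))%N); last by have := ltn_ord x; lia.
by apply: eq_bigr => d _; rewrite addnK.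
Qed.

Lemma sum_short_le x (F : nat -> R) : (forall d, 0 <= F d) ->
  \sum_(y | short x y) F (y - x)%N <= \sum_(1 <= d < W) F d.
Proof.
move=> F0; rewrite sum_short_eq; have := ltn_ord x => ltx.
rewrite [X in _ <= X](@big_cat_nat _ _ _ (minn W (N - x))) /=; try lia.
by rewrite lerDl sumr_ge0.
Qed.

Lemma card_short x : \sum_(y | short x y) 1 <= W%:R :> R.
Proof.
apply: le_trans (sum_short_le x (F := fun=> 1) _) _; first by move=> _; apply: ler01.
by rewrite sumr_const_nat ler_nat leq_subr.
Qed.

(** Only the starting points [x < N - W] are kept: there the whole range of lengths fits, and [y.+1]
    is a free point for [expect_iso_lower]. *)
Lemma expect_short_lower : (W < N)%N ->
  (N - W)%:R * gpart R W <= expect short_iso.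
Proof.
move=> WN; rewrite /short_iso expect_sum.
apply: (@le_trans _ _ (\sum_(x < N) (if (x < N - W)%N then gpart R W else 0))).
  rewrite -big_mkcond -(big_ord_widen N (fun=> gpart R W)) ?leq_subr //.
  by rewrite sumr_const card_ord mulr_natl.
apply: ler_sum => x _; rewrite expect_sum.
have e0 y : 0 <= expect (fun m => (iso_arc m x y)%:R) :> R.
  by apply: expect_ge0 => m; rewrite ler0n.
case: ifP => [xN|_]; last by rewrite sumr_ge0.
rewrite /gpart -(_ : minn W (N - x) = W) -?sum_short_eq; last by lia.
apply: ler_sum => y /andP[xy yW].
have zN : (y.+1 < N)%N by lia.
by apply: (expect_iso_lower R evenN (z := Ordinal zN)) => //=; rewrite ltnSn orbT.
Qed.

(** Starting points at distance less than [W] get the trivial bound 1; otherwise the intervals are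
    disjoint and [expect_iso2_upper] applies in one of the two orders. *)
Lemma expect_iso_pair (e : R) K x y x' y' :
  0 <= e -> ratio_good e (2 * W) K -> (2 * W < N)%N -> (K < N)%N ->
  short x y -> short x' y' ->
  expect (fun m => (iso_arc m x y && iso_arc m x' y')%:R) <=
  (1 + e) ^+ 2 * (qarc R (y - x) * qarc R (y' - x')) +
  (4 * ((K * K)%:R / (N - K)%:R) + ((x' < x + W) && (x < x' + W))%N%:R).
Proof.
move=> e0 good WN KN sxy sxy'.
set rho := 4 * _; have rho0 : 0 <= rho by rewrite mulr_ge0 ?divr_ge0 ?ler0n.
have q0 : 0 <= (1 + e) ^+ 2 * (qarc R (y - x) * qarc R (y' - x')).
  by rewrite mulr_ge0 ?exprn_ge0 ?addr_ge0 // mulr_ge0 ?qarc_ge0.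
have [near|far] := boolP ((x' < x + W) && (x < x' + W))%N.
  have N0 : (0 < N)%N by lia.
  apply: (@le_trans _ _ 1); last by rewrite -[true%:R]/1; lra.
  rewrite -[X in _ <= X](expect1 R evenN N0); apply: ler_expect => c m _ _.
  by rewrite lern1 leq_b1.
rewrite addr0.
have main (a b a' b' : 'I_N) : short a b -> short a' b' -> (b < a')%N ->
    expect (fun m => (iso_arc m a b && iso_arc m a' b')%:R) <=
    (1 + e) ^+ 2 * (qarc R (b - a) * qarc R (b' - a')) + rho.
  move=> /andP[ab abW] /andP[ab' abW'] ba'.
  (* If the arcs occupy both extreme points, [2 * W < N] leaves a gap between them, and [b.+1] lies
     in it. *)
  have [z z1 z2] : exists2 z : 'I_N, (z < a)%N || (b < z)%N & (z < a')%N || (b' < z)%N.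
    have lt0N : (0 < N)%N by lia.
    have ltmN : (N.-1 < N)%N by lia.
    have ltbN : (b.+1 < N)%N by have := ltn_ord b'; lia.
    have [a0|a0] := posnP a; last by exists (Ordinal lt0N) => /=; lia.
    have [bN|bN] := ltnP b' N.-1; first by exists (Ordinal ltmN) => /=; lia.
    by exists (Ordinal ltbN) => /=; lia.
  by apply: (expect_iso2_upper evenN e0 good _ ab ba' ab' z1 z2 KN); lia.
move: (sxy) (sxy') => /andP[? ?] /andP[? ?].
have [h|h] := ltnP y x'; first exact: main.
rewrite [qarc _ _ * _]mulrC.
rewrite (eq_expect (g := fun m => (iso_arc m x' y' && iso_arc m x y)%:R)); last first.
  by move=> m; rewrite andbC.
by apply: main => //; lia.
Qed.

(** The square expands into a sum over pairs of arcs, bounded by [expect_iso_pair]. Each [x] has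
    fewer than [2 * W] near starting points, each with at most [W] possible ends. *)
Lemma expect_short_sq (e : R) K :
  0 <= e -> ratio_good e (2 * W) K -> (2 * W < N)%N -> (K < N)%N ->
  expect (fun m => short_iso m ^+ 2) <=
  (1 + e) ^+ 2 * (N%:R * gpart R W) ^+ 2 +
  (4 * ((K * K)%:R / (N - K)%:R) * (N%:R * W%:R) ^+ 2 + N%:R * W%:R * (2 * W%:R * W%:R)).
Proof.
move=> e0 good WN KN.
set rho := 4 * _; have rho0 : 0 <= rho by rewrite mulr_ge0 ?divr_ge0 ?ler0n.
pose nr x x' := ((x' < x + W) && (x < x' + W))%N.
pose Q x := \sum_(y | short x y) qarc R (y - x).
pose C x : R := \sum_(y | short x y) 1.
have Q0 x : 0 <= Q x by rewrite sumr_ge0 // => y _; apply: qarc_ge0.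
have C0 x : 0 <= C x by rewrite sumr_ge0.
have Ql x : Q x <= gpart R W by apply: sum_short_le => d; apply: qarc_ge0.
have CW x : C x <= W%:R by apply: card_short.
apply: (@le_trans _ _ (\sum_x \sum_(y | short x y) \sum_x' \sum_(y' | short x' y')
   ((1 + e) ^+ 2 * (qarc R (y - x) * qarc R (y' - x')) + (rho + (nr x x')%:R)))).
  rewrite (eq_expect (g := fun m => \sum_x \sum_(y | short x y) \sum_x'
      \sum_(y' | short x' y') (iso_arc m x y && iso_arc m x' y')%:R)); last first.
    move=> m; rewrite expr2 /short_iso mulr_suml; apply: eq_bigr => x _.
    rewrite mulr_suml; apply: eq_bigr => y _; rewrite mulr_sumr; apply: eq_bigr => x' _.
    by rewrite mulr_sumr; apply: eq_bigr => y' _; rewrite -natrM mulnb.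
  rewrite expect_sum; apply: ler_sum => x _; rewrite expect_sum; apply: ler_sum => y sxy.
  rewrite expect_sum; apply: ler_sum => x' _; rewrite expect_sum; apply: ler_sum => y' sxy'.
  exact: expect_iso_pair.
have -> : \sum_x \sum_(y | short x y) \sum_x' \sum_(y' | short x' y')
   ((1 + e) ^+ 2 * (qarc R (y - x) * qarc R (y' - x')) + (rho + (nr x x')%:R)) =
   (1 + e) ^+ 2 * (\sum_x Q x) ^+ 2 +
   (rho * (\sum_x C x) ^+ 2 + \sum_x C x * \sum_x' (nr x x')%:R * C x').
  rewrite !expr2 !mulr_suml !mulr_sumr -!big_split /=; apply: eq_bigr => x _.
  rewrite [Q x]/Q [C x]/C !mulr_suml !mulr_sumr -!big_split /=; apply: eq_bigr => y _.
  rewrite !mulr_sumr -!big_split /=; apply: eq_bigr => x' _.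
  rewrite /Q /C !mulr_sumr -!big_split /=; apply: eq_bigr => y' _.
  ring.
have sQ : \sum_x Q x <= N%:R * gpart R W.
  by rewrite mulr_natl -[X in _ *+ X]card_ord -sumr_const ler_sum.
have sC : \sum_x C x <= N%:R * W%:R.
  by rewrite mulr_natl -[X in _ *+ X]card_ord -sumr_const ler_sum.
have near x : \sum_x' (nr x x')%:R * C x' <= 2 * W%:R * W%:R.
  apply: (@le_trans _ _ (\sum_x' (nr x x')%:R * W%:R)).
    by apply: ler_sum => x' _; rewrite ler_wpM2l ?ler0n.
  rewrite -mulr_suml ler_wpM2r ?ler0n // -natr_sum -natrM ler_nat.
  have -> : (\sum_x' nr x x' = #|[set z : 'I_N | (x.+1 - W <= z) && (z < x + W)]|)%N.
    rewrite -sum1dep_card [RHS]big_mkcond; apply: eq_bigr => z _.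
    rewrite (_ : ((x.+1 - W <= z) && (z < x + W))%N = nr x z); first by case: (nr x z).
    by rewrite /nr; lia.
  by rewrite card_ord_interval; lia.
have sQ0 : 0 <= \sum_x Q x by rewrite sumr_ge0.
have sC0 : 0 <= \sum_x C x by rewrite sumr_ge0.
apply: lerD.
  by rewrite ler_wpM2l ?exprn_ge0 ?addr_ge0 // ler_sqr ?nnegrE // (le_trans sQ0).
apply: lerD.
  by rewrite ler_wpM2l // ler_sqr ?nnegrE // (le_trans sC0).
apply: (@le_trans _ _ (\sum_x C x * (2 * W%:R * W%:R))).
  by apply: ler_sum => x _; rewrite ler_wpM2l.
by rewrite -mulr_suml ler_wpM2r // !mulr_ge0 ?ler0n.
Qed.

End ShortArcs.

(** On [2 * W] points the expected number of short isolated arcs is at least [W * gpart R W] and at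
    most the number of points. This bound also yields convergence of the series for gamma. *)
Lemma gpart_le2 (R : realFieldType) W : gpart R W <= 2.
Proof.
have [->|W0] := posnP W; first by rewrite /gpart big_geq // ler0n.
have evenN : ~~ odd (2 * W) by lia.
have lt : (W < 2 * W)%N by lia.
have := expect_short_lower R evenN W0 lt.
have le : expect (short_iso R (N := 2 * W) W) <=
    expect (N := 2 * W) (fun=> (2 * W)%:R * 1).
  by apply: ler_expect => c m _ _; rewrite mulr1; apply: short_iso_le.
rewrite expectZ expect1 // ?mulr1 in le; last by lia.
move=> /le_trans /(_ le); rewrite (_ : (2 * W - W = W)%N) ?natrM; last by lia.
by rewrite [2 * _]mulrC ler_pM2l // ltr0n.
Qed.

Lemma archi_ratio_small (R : archiRealFieldType) (C e : R) K : 0 <= C -> 0 < e ->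
  exists N0, forall N, (N0 <= N)%N -> (K < N)%N /\ C / (N - K)%:R <= e.
Proof.
move=> C0 e0; exists (K + (Num.bound (C / e)).+1)%N => N leN; split; first by lia.
have NK : 0 < (N - K)%:R :> R by rewrite ltr0n subn_gt0; lia.
rewrite ler_pdivrMr // mulrC -ler_pdivrMr //.
apply: le_trans (ltW (archi_boundP _)) _; first by rewrite divr_ge0 // ltW.
by rewrite ler_nat leq_subRL; [apply: leq_trans leN; rewrite leq_add2l | lia].
Qed.

(** Completing the square; it replaces Cauchy-Schwarz in passing from second to first moments. *)
Lemma norm_le_sq (R : realFieldType) (d z : R) : 0 < d -> `|z| <= d / 2 + z ^+ 2 / (2 * d).
Proof.
move=> d0; rewrite -[z ^+ 2]real_normK ?num_real //.
have : 0 <= `|z| by []; move: `|z| => t t0.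
have -> : d / 2 + t ^+ 2 / (2 * d) = t + (t - d) ^+ 2 / (2 * d).
  by field; rewrite gt_eqF.
by rewrite lerDl divr_ge0 ?sqr_ge0 // mulr_ge0 // ltW.
Qed.

(** Expanding around [mu], the second moment is bounded above and the first below. The leading terms
    cancel up to [(2e + e^2) gpart^2], at most [12 e]; the rest is controlled through
    [N <= N^2 / (N - K)]. *)
Lemma short_variance (R : realFieldType) (e : R) N W K :
  ~~ odd N -> (0 < W)%N -> 0 <= e -> e <= 1 -> ratio_good e (2 * W) K ->
  (2 * W < N)%N -> (K < N)%N ->
  expect (fun m : {ffun 'I_N -> 'I_N} => (short_iso R W m - N%:R * gpart R W) ^+ 2) <=
  N%:R ^+ 2 * (12 * e + (8 * W%:R + 4 * (K * K)%:R * W%:R ^+ 2 + 2 * W%:R ^+ 3) / (N - K)%:R).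
Proof.
move=> evenN W0 e0 e1 good WN KN.
have lt : (W < N)%N by lia.
have N0 : (0 < N)%N by lia.
have h1 := expect_short_lower R evenN W0 lt.
have h2 := expect_short_sq evenN W0 e0 good WN KN.
set mu := N%:R * gpart R W in h2 *.
rewrite (eq_expect (g := fun m => short_iso R W m ^+ 2 +
   ((- (2 * mu)) * short_iso R W m + mu ^+ 2 * 1))); last by move=> m; ring.
rewrite expectD expectD !expectZ (expect1 R evenN N0) mulr1.
have g0 := gpart_ge0 R W; have g2 := gpart_le2 R W.
have n0 : 0 < N%:R :> R by rewrite ltr0n.
have w0 : 0 <= W%:R :> R by rewrite ler0n.
have NK0 : 0 < (N - K)%:R :> R by rewrite ltr0n subn_gt0.
have invN : N%:R^-1 <= (N - K)%:R^-1 :> R.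
  by rewrite lef_pV2 ?posrE // ler_nat leq_subr.
have k0 : 0 <= (K * K)%:R :> R by rewrite ler0n.
rewrite natrB 1?ltnW // in h1.
have mu0 : 0 <= mu by rewrite mulr_ge0 // ltW.
have h3 : 2 * mu * ((N%:R - W%:R) * gpart R W) <= 2 * mu * expect (short_iso R W (N := N)).
  by rewrite ler_wpM2l // mulr_ge0.
set X := expect _ in h2 *; set Y := expect _ in h1 h3 *.
have {}g2 : gpart R W ^+ 2 <= 4 by rewrite expr2; nra.
have b : N%:R <= N%:R ^+ 2 / (N - K)%:R :> R.
  rewrite expr2 -mulrA -[X in X <= _]mulr1 ler_wpM2l ?(ltW n0) //.
  by rewrite ler_pdivlMr // mul1r ler_nat leq_subr.
have a1 : (2 * e + e ^+ 2) * gpart R W ^+ 2 <= 12 * e.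
  apply: (@le_trans _ _ ((3 * e) * 4)); last lra.
  by apply: ler_pM; rewrite ?sqr_ge0 //; rewrite expr2; nra.
have a2 : N%:R ^+ 2 * ((2 * e + e ^+ 2) * gpart R W ^+ 2) <= N%:R ^+ 2 * (12 * e) :> R.
  by rewrite ler_wpM2l ?sqr_ge0.
have a3 : 2 * W%:R * N%:R * gpart R W ^+ 2 <= 2 * W%:R * N%:R * 4.
  by rewrite ler_wpM2l // !mulr_ge0 ?ler0n.
have a4 : (8 * W%:R + 2 * W%:R ^+ 3) * N%:R <=
    (8 * W%:R + 2 * W%:R ^+ 3) * (N%:R ^+ 2 / (N - K)%:R) :> R.
  by rewrite ler_wpM2l // addr_ge0 ?mulr_ge0 ?exprn_ge0.
rewrite /mu in h2 h3 *; move: h2 h3 a2 a3 a4.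
move: (N - K)%:R^-1 (K * K)%:R => ik kk; lra.
Qed.

Lemma short_L1 (R : archiRealFieldType) W (d : R) : (0 < W)%N -> 0 < d ->
  exists N0, forall N, (N0 <= N)%N -> ~~ odd N ->
  expect (fun m : {ffun 'I_N -> 'I_N} => `|short_iso R W m - N%:R * gpart R W|) <= d * N%:R.
Proof.
(* With this [e] the variance bound is at most [(d * N)^2], half from [12 * e] and half from the
   term that decays with [N]. *)
move=> W0 d0; pose e := Num.min (d ^+ 2 / 24) 1.
have d20 : 0 < d ^+ 2 by rewrite exprn_gt0.
have e0 : 0 < e by rewrite lt_min ltr01 divr_gt0 ?ltr0n.
have e1 : e <= 1 by rewrite ge_min lexx orbT.
have ed : 12 * e <= d ^+ 2 / 2.
  have : e <= d ^+ 2 / 24 by rewrite ge_min lexx.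
  lra.
have [K good] := ratio_good_exists (2 * W) e0.
pose C : R := 8 * W%:R + 4 * (K * K)%:R * W%:R ^+ 2 + 2 * W%:R ^+ 3.
have C0 : 0 <= C by rewrite !addr_ge0 ?mulr_ge0 ?exprn_ge0 ?ler0n.
have dd0 : 0 < d ^+ 2 / 2 by rewrite divr_gt0.
have [N1 hN1] := archi_ratio_small K C0 dd0.
exists (maxn N1 (2 * W).+1) => N; rewrite geq_max => /andP[/hN1[KN hC] WN] evenN.
have N0 : (0 < N)%N by lia.
have n0 : 0 < N%:R :> R by rewrite ltr0n.
have var := short_variance evenN W0 (ltW e0) e1 good WN KN.
have dn0 : 0 < d * N%:R by rewrite mulr_gt0.
apply: (@le_trans _ _ (expect (fun m : {ffun 'I_N -> 'I_N} => (d * N%:R / 2) * 1 +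
   (2 * (d * N%:R))^-1 * (short_iso R W m - N%:R * gpart R W) ^+ 2))).
  apply: ler_expect => c m _ _; apply: le_trans (norm_le_sq _ dn0) _.
  by rewrite mulr1 [X in _ + X]mulrC.
rewrite expectD !expectZ (expect1 R evenN N0) mulr1.
have v2 : N%:R ^+ 2 * (12 * e + C / (N - K)%:R) <= N%:R ^+ 2 * d ^+ 2.
  by rewrite ler_wpM2l ?sqr_ge0 //; lra.
have := le_trans var v2; set V := expect _ => hV.
have : (2 * (d * N%:R))^-1 * V <= d * N%:R / 2.
  rewrite ler_pdivrMl ?mulr_gt0 // (le_trans hV) // le_eqVlt; apply/orP; left.
  by apply/eqP; field.
lra.
Qed.

Definition iso_total (R : realFieldType) N (m : {ffun 'I_N -> 'I_N}) : R :=
  \sum_(x : 'I_N) \sum_(y : 'I_N | (x < y)%N) (iso_arc m x y)%:R.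

Lemma iso_total_split (R : realFieldType) N W (m : {ffun 'I_N -> 'I_N}) : (0 < W)%N ->
  iso_total R m = short_iso R W m +
    \sum_(x : 'I_N) \sum_(y : 'I_N | (x + W <= y)%N) (iso_arc m x y)%:R.
Proof.
move=> W0; rewrite -big_split; apply: eq_bigr => x _ /=.
rewrite (bigID (fun y : 'I_N => y < x + W)%N) /=; congr (_ + _).
by apply: eq_bigl => y; lia.
Qed.

(** [W1] depends on [e] alone and [W] stays free above it, so that [W] can later be chosen with
    [2 * gpart R W] close to gamma. The four quarters of [e] pay for the short arcs, [cbin], the
    rare colourings and the first [W] points. *)
Theorem iso_total_L1 (R : archiRealFieldType) (e : R) : 0 < e ->
  exists W1, forall W, (W1 <= W)%N -> exists N0, forall N, (N0 <= N)%N -> ~~ odd N ->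
  expect (fun m : {ffun 'I_N -> 'I_N} => `|iso_total R m - N%:R * gpart R W|) <= e * N%:R.
Proof.
move=> e0; have e40 : 0 < e / 4 by rewrite divr_gt0.
have [l hl] := cbin_small e40.
have C0 : 0 <= 8 * (2 * l * (2 * l))%:R :> R by rewrite mulr_ge0 ?ler0n.
have [W1 hW1] := archi_ratio_small (2 * l) C0 e40.
exists W1.+1 => W leW; have leW1 : (W1 <= W.-1)%N by lia.
have [lW hB] := hW1 _ leW1.
have W0 : (0 < W)%N by lia.
have [N1 hN1] := short_L1 W0 e40.
have [N2 hN2] := archi_ratio_small 0 (ler0n R W) e40.
exists (maxn N1 N2) => N; rewrite geq_max => /andP[leN1 /hN2[N0 hN]] evenN.
rewrite subn0 ler_pdivrMr ?ltr0n // in hN.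
pose tl m : R := \sum_(x : 'I_N) \sum_(y : 'I_N | (x + W <= y)%N) (iso_arc m x y)%:R.
have tl0 m : 0 <= tl m by rewrite sumr_ge0 // => x _; rewrite sumr_ge0 // => y _; rewrite ler0n.
apply: (@le_trans _ _ (expect (fun m : {ffun 'I_N -> 'I_N} =>
    `|short_iso R W m - N%:R * gpart R W| + tl m))).
  apply: ler_expect => c m _ _; rewrite (iso_total_split _ _ W0) -/(tl m) addrAC.
  by apply: le_trans (ler_normD _ _) _; rewrite (ger0_norm (tl0 m)).
rewrite expectD; have h1 := hN1 N leN1 evenN.
have h2 := expect_tail R evenN lW; rewrite -/tl in h2.
have : N%:R * (cbin R l + 8 * ((2 * l * (2 * l))%:R / (W.-1 - 2 * l)%:R)) <=
   N%:R * (e / 4 + e / 4).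
  by rewrite ler_wpM2l ?ler0n // lerD // mulrA.
lra.
Qed.

(** * Transfer to the real numbers of the standard library *)

Lemma Rsum_filter_enum (T : finType) (P : pred T) (f : T -> R) :
  Rsum [seq x <- enum T | P x] f = \sum_(x | P x) f x.
Proof.
have -> (s : seq T) : Rsum s f = \sum_(x <- s) f x.
  by elim: s => [|x s IHs]; rewrite ?big_nil ?big_cons //= IHs.
by rewrite big_filter big_enum_cond.
Qed.

Lemma size_valid_pairs n (c : coloring n) :
  size (valid_pairs c) = #|[set m | ncmatching c m]|.
Proof.
rewrite /valid_pairs -sum1_size big_filter big_enum_cond -sum1dep_card.
by apply: eq_bigl => m; rewrite andTb.
Qed.

Lemma Rsum_expect n (f : partner n -> R) :
  Rsum (even_colorings n) (fun c => Rmult (pow (Rinv 2) (2 * n - 1))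
     (Rsum (valid_pairs c) (fun m => Rdiv (f m) (INR (size (valid_pairs c)))))) =
  expect f.
Proof.
rewrite /even_colorings Rsum_filter_enum /expect /avge mulr_sumr.
apply: eq_big => [c|c _].
  by congr (~~ odd _); apply: eq_card => z; rewrite !inE eqb_id.
rewrite !RealsE subn1 exprVn; congr (_ * _).
rewrite size_valid_pairs /valid_pairs Rsum_filter_enum /expm mulr_suml.
by apply: eq_bigr => m _; rewrite !RealsE.
Qed.

Lemma iso_total_isolated (F : realFieldType) n (m : partner n) :
  iso_total F m = (isolated m)%:R.
Proof.
rewrite /isolated -sum1dep_card natr_sum [RHS]big_mkcond; apply: eq_bigr => x _.
rewrite big_mkcond (bigD1 (m x)) //= big1 => [|y /negbTE ymx]; last first.
  by rewrite /iso_arc eq_sym ymx /=; case: ifP.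
rewrite addr0 /iso_arc eqxx /=; case: (x < m x)%N => //=.
by rewrite -[[forall y, _]]/[forall z, ~~ (crossing m x z || crossing m z x)]; case: [forall z, _].
Qed.

Lemma sum_odd (F : realFieldType) (f : nat -> F) M : (forall d, (0 < d)%N -> ~~ odd d -> f d = 0) ->
  \sum_(1 <= d < (2 * M).+1) f d = \sum_(0 <= k < M) f (2 * k).+1.
Proof.
move=> f0; elim: M => [|M IHM]; first by rewrite !big_geq.
rewrite (_ : (2 * M.+1).+1 = (2 * M).+3)%N; last by lia.
have f2 : f (2 * M).+2 = 0 by apply: f0; lia.
by rewrite [LHS]big_nat_recr //= [X in X + _]big_nat_recr //= IHM [RHS]big_nat_recr //= f2 addr0.
Qed.

(** An even distance leaves an odd number of points inside, so one of the two colours has an odd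
    count there. *)
Lemma qarc_even (F : realFieldType) d : (0 < d)%N -> ~~ odd d -> qarc F d = 0.
Proof.
move=> d0 ed; rewrite /qarc big1 ?mulr0 // => a _.
have [oa|ea] := boolP (odd a); first by rewrite (catpts_odd oa) mulr0.
by rewrite (@catpts_odd (d.-1 - a)) ?muln0 ?mulr0 //; have := ltn_ord a; lia.
Qed.

Lemma inv16X (F : realFieldType) k :
  16^-1 ^+ k.+1 = 16^-1 * (2 ^- (2 * k) * 2 ^- (2 * k)) :> F.
Proof.
rewrite exprS -invfM -exprD exprVn; congr (_ * _^-1).
by rewrite (_ : 2 * k + 2 * k = 4 * k)%N ?exprM -?natrX //; lia.
Qed.

Lemma pow2V (F : realFieldType) k : 2 ^- (2 * k).+2 = 4^-1 * 2 ^- (2 * k) :> F.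
Proof. by rewrite !exprS !invfM mulrA; congr (_ * _); field. Qed.

(** The factor 2 appears because [qarc] is a density per point, while gamma is relative to [n] on
    [2 * n] points. Only even [a] survive in [qarc], which gives the binomials
    ['C(2 * k, 2 * b)]. *)
Lemma gamma_termS k : gamma_term k.+1 = 2 * qarc R (2 * k).+1.
Proof.
rewrite /gamma_term /qarc !RealsE /=.
under [in RHS]eq_bigr do rewrite -natrM.
rewrite -natr_sum (sum_even_support k
  (f := fun a => 'C(2 * k, a) * (catpts a * catpts (2 * k - a)))%N); last first.
  by move=> a oa; rewrite (catpts_odd oa) muln0.
set S := (\sum_(b < k.+1) _)%N; set S' := (\sum_(b < k.+1) _)%N.
have -> : S = S'.
  apply: eq_bigr => b _; rewrite -mulnBr !catpts_double -mulnA [(catalan b * _)%N]mulnC.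
  by congr ('C(_, _) * (catalan _ * _))%N; lia.
rewrite inv16X pow2V.
by field; rewrite pow2_neq0.
Qed.

(** * Convergence of the series for gamma *)

Lemma gamma_term_ge0 k : 0 <= gamma_term k.
Proof.
case: k => [|k]; first exact: lexx.
by rewrite gamma_termS mulr_ge0 ?qarc_ge0.
Qed.

Lemma sum_gamma_term M : sum_f_R0 gamma_term M = 2 * gpart R (2 * M).+1.
Proof.
rewrite RealsE big_nat_recl // [gamma_term 0]/(0 : R) add0r /gpart sum_odd => [|d]; last exact: qarc_even.
by rewrite mulr_sumr; apply: eq_bigr => k _; rewrite gamma_termS.
Qed.

Lemma gamma_exists : exists2 g : R, 0 < g & Un_cv (sum_f_R0 gamma_term) g.
Proof.
have grow : Un_growing (sum_f_R0 gamma_term).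
  by move=> M; apply/RleP; rewrite tech5 RplusE lerDl gamma_term_ge0.
have ub : has_ub (sum_f_R0 gamma_term).
  exists 4 => y [M ->]; apply/RleP; rewrite sum_gamma_term.
  by have := gpart_le2 R (2 * M).+1; lra.
have [g cvg] := growing_cv _ grow ub.
(* The partial sum of index 1 already contains [qarc R 1], which is positive. *)
exists g => //; have /RleP := growing_ineq _ _ grow cvg 1%N.
apply: lt_le_trans; rewrite sum_gamma_term.
rewrite mulr_gt0 // /gpart big_ltn // ltr_wpDr ?sumr_ge0 // => [d _|].
  exact: qarc_ge0.
by rewrite /qarc big_ord1 !mulr_gt0 ?invr_gt0 ?exprn_gt0 // ltr01.
Qed.

Lemma isolated_L1 (g e : R) : Un_cv (sum_f_R0 gamma_term) g -> 0 < e ->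
  exists n0, forall n, (n0 <= n)%N ->
  expect (fun m : partner n => `|(isolated m)%:R - g * n%:R|) <= e * n%:R.
Proof.
move=> cvg e0; have e20 : 0 < e / 2 by rewrite divr_gt0.
(* A quarter, since there are [2 * n] points: [e / 4 * (2 * n) + e / 2 * n = e * n]. *)
have e40 : 0 < e / 4 by rewrite divr_gt0.
have [W1 hW1] := iso_total_L1 e40.
have [M1 hM1] := cvg _ (elimT RltP e20).
pose M := maxn M1 W1.
have [|N0 hN0] := hW1 (2 * M).+1; first by rewrite /M; lia.
have hg : `|2 * gpart R (2 * M).+1 - g| <= e / 2.
  have leM : (M1 <= M)%coq_nat by apply/ssrnat.leP; rewrite leq_maxl.
  by have /RltP := hM1 M leM; rewrite RdistE sum_gamma_term => /ltW.
exists (maxn N0 1) => n; rewrite geq_max => /andP[leN n0].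
have evenN : ~~ odd (2 * n) by rewrite oddM.
have leN2 : (N0 <= 2 * n)%N by lia.
have h := hN0 _ leN2 evenN.
apply: (@le_trans _ _ (expect (fun m : partner n =>
    `|iso_total R m - (2 * n)%:R * gpart R (2 * M).+1| + e / 2 * n%:R * 1))).
  apply: ler_expect => c m _ _; rewrite iso_total_isolated mulr1.
  apply: le_trans (ler_distD ((2 * n)%:R * gpart R (2 * M).+1) _ _) _.
  rewrite lerD2l natrM.
  have -> : 2 * n%:R * gpart R (2 * M).+1 - g * n%:R = (2 * gpart R (2 * M).+1 - g) * n%:R.
    by ring.
  by rewrite normrM [`|n%:R|]ger0_norm ?ler0n // ler_wpM2r ?ler0n.
rewrite expectD expectZ expect1 // ?mulr1; last by lia.
by move: h; rewrite natrM; lra.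
Qed.

(** * From the first absolute moment to the two limits *)

Lemma expect_norm_le N (f : {ffun 'I_N -> 'I_N} -> R) :
  `|expect f| <= expect (fun m => `|f m|).
Proof.
rewrite ler_norml; apply/andP; split; last first.
  by apply: ler_expect => c m _ _; apply: ler_norm.
rewrite -mulN1r -expectZ; apply: ler_expect => c m _ _; rewrite mulN1r.
by rewrite lerNl -normrN ler_norm.
Qed.

Lemma prob_close_le1 n (g e : R) : (0 < n)%N -> prob_close n g e <= 1.
Proof.
move=> n0; rewrite /prob_close Rsum_expect.
rewrite -[X in _ <= X](@expect1 R (2 * n)) ?oddM ?muln_gt0 //.
by apply: ler_expect => c m _ _; case: Rlt_dec => _ //; exact: ler01.
Qed.

(** Markov's inequality, from the pointwise bound of the indicator below by one minus the scaled
    deviation. *)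
Lemma prob_close_markov n (g e : R) : (0 < n)%N -> 0 < e ->
  1 - expect (fun m : partner n => `|(isolated m)%:R - g * n%:R|) / (e * n%:R) <=
  prob_close n g e.
Proof.
move=> n0 e0; have n0R : 0 < n%:R :> R by rewrite ltr0n.
have en0 : 0 < e * n%:R by rewrite mulr_gt0.
rewrite /prob_close Rsum_expect -[X in X - _](@expect1 R (2 * n)) ?oddM ?muln_gt0 //.
rewrite mulrC -mulNr -expectZ -expectD; apply: ler_expect => c m _ _.
rewrite mulNr mulrC; case: Rlt_dec => /= far.
  by rewrite gerBl divr_ge0 // ltW.
move/RltP: far; rewrite !RealsE -leNgt => far.
by rewrite subr_le0 ler_pdivlMr // mul1r.
Qed.

Lemma expected_isolated_error n (g : R) : (0 < n)%N ->
  `|expected_isolated n - g * n%:R| <=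
  expect (fun m : partner n => `|(isolated m)%:R - g * n%:R|).
Proof.
move=> n0; apply: le_trans (expect_norm_le _).
rewrite /expected_isolated (Rsum_expect (fun m => INR (isolated m))).
rewrite (eq_expect (g := fun m => (isolated m)%:R)); last by move=> m; rewrite INRE.
rewrite (eq_expect (f := fun m => _ - _) (g := fun m => (isolated m)%:R + - (g * n%:R) * 1)).
  by rewrite expectD expectZ expect1 ?mulr1 ?oddM ?muln_gt0.
by move=> m; rewrite mulr1.
Qed.

Lemma expected_isolated_cvg (g : R) : 0 < g -> Un_cv (sum_f_R0 gamma_term) g ->
  Un_cv (fun n => Rdiv (expected_isolated n) (Rmult g (INR n))) (IZR 1).
Proof.
(* After division by [g * n] the error is [e / 2], strictly below [e]. *)
move=> g0 cvg e /RltP e0; have eg0 : 0 < e * g / 2 by rewrite divr_gt0 ?mulr_gt0.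
have [n0 hn0] := isolated_L1 cvg eg0.
exists n0.+1 => n /ssrnat.leP n0n; apply/RltP; rewrite RdistE !RealsE.
have n_gt0 : (0 < n)%N by lia.
have n0R : 0 < n%:R :> R by rewrite ltr0n.
have gn0 : 0 < g * n%:R by rewrite mulr_gt0.
have -> : expected_isolated n / (g * n%:R) - 1 =
    (expected_isolated n - g * n%:R) / (g * n%:R).
  by field; rewrite !gt_eqF.
rewrite normrM [`|_^-1|]gtr0_norm ?invr_gt0 // ltr_pdivrMr //.
apply: le_lt_trans (expected_isolated_error _ n_gt0) _.
apply: le_lt_trans (hn0 n (ltnW n0n)) _.
by rewrite mulrA ltr_pM2r // ltr_pdivrMr ?ltr0n // ltr_pMr ?mulr_gt0 // ltr1n.
Qed.

Lemma prob_close_cvg (g e : R) : Un_cv (sum_f_R0 gamma_term) g -> 0 < e ->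
  Un_cv (fun n => prob_close n g e) (IZR 1).
Proof.
move=> cvg e0 d /RltP; rewrite RealsE => d0; have ed0 : 0 < e * d / 2 by rewrite divr_gt0 ?mulr_gt0.
have [n0 hn0] := isolated_L1 cvg ed0.
exists n0.+1 => n /ssrnat.leP n0n; apply/RltP; rewrite RdistE !RealsE.
have n_gt0 : (0 < n)%N by lia.
have en0 : 0 < e * n%:R by rewrite mulr_gt0 ?ltr0n.
have le1 := prob_close_le1 g e n_gt0.
have markov := prob_close_markov g n_gt0 e0.
have small : expect (fun m : partner n => `|(isolated m)%:R - g * n%:R|) / (e * n%:R) <= d / 2.
  rewrite ler_pdivrMr // (le_trans (hn0 n (ltnW n0n))) // le_eqVlt; apply/orP; left.
  by apply/eqP; field.
rewrite distrC ger0_norm ?subr_ge0 //; move: d0 small markov le1; lra.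
Qed.

(* MathComp binds the key [%R] to [ring_scope]. *)
Delimit Scope R_scope with R.

Theorem theorem1p2 :
  exists gamma : R,
    infinite_sum gamma_term gamma /\
    Un_cv (fun n => (expected_isolated n / (gamma * INR n))%R) 1%R /\
    (forall eps : R, (0 < eps)%R -> Un_cv (fun n => prob_close n gamma eps) 1%R).
Proof.
have [g g_gt0 cvg] := gamma_exists; exists g; split; first exact: cvg.
split; first exact: expected_isolated_cvg.
by move=> e /RltP e0; apply: prob_close_cvg.
Qed.
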